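(* Fix a prime $p\ge5$ and assume that \[ [q^{np}]\,C(q)U_p(q)^\ell\equiv0\pmod{p^4}\qquad(n\ge1,\ \ell=1,2,3). \] Then $A_{mp}\equiv A_m\pmod{p^4}$ for all $m\ge1$.
   Context: $A_n=27^n[z^n]\,{}_2F_1(\tfrac13,\tfrac13;1;z)^3$. $\chi_3(n)=\left(\frac{n}{3}\right)$; $C(q)=1+\sum_{n\ge1}c_nq^n$, $c_n=3\sum_{d\mid n}\chi_3(d)d^4$; $t(q)=q\prod_{n\ge1}(1-q^{3n})^{12}(1-q^n)^{-12}$; $U_p(q):=\log\bigl(t(q)^p/t(q^p)\bigr)$ (formal logarithm). Congruence mod $p^4$ means the difference lies in $p^4\mathbf{Z}_{(p)}$. *)

(* Defs.v *)
From HB Require Import structures.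
From mathcomp Require Import all_boot all_order all_algebra.
From mathcomp Require Import boolp.

Set Implicit Arguments.
Unset Strict Implicit.
Unset Printing Implicit Defensive.

Import Order.TTheory GRing.Theory Num.Theory.
Local Open Scope ring_scope.

(* Formal power series in one variable over a field, as a commutative ring in
   which the invertible elements are the series with nonzero constant term.
   The functions on series below carry no proof arguments; where they are meant
   only for a restricted class of series, this is said at the definition. *)

Record fps (F : fieldType) : Type := Fps { fcoef : nat -> F }.

HB.instance Definition _ (F : fieldType) := gen_eqMixin (fps F).
HB.instance Definition _ (F : fieldType) := gen_choiceMixin (fps F).

Section FpsRing.
Variable F : fieldType.
Implicit Types f g h : fps F.

Lemma fpsP f g : fcoef f =1 fcoef g <-> f = g.
Proof.
split=> [|-> //]; case: f => f; case: g => g /= fg.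
by congr Fps; apply/funext.
Qed.

Definition fpsC (c : F) : fps F := Fps (fun n => if n == 0%N then c else 0).
Definition fps_add f g : fps F := Fps (fun n => fcoef f n + fcoef g n).
Definition fps_opp f : fps F := Fps (fun n => - fcoef f n).
Definition fps_mul f g : fps F :=
  Fps (fun n => \sum_(i < n.+1) fcoef f i * fcoef g (n - i)%N).

Lemma fps_addA : associative fps_add.
Proof. by move=> f g h; apply/fpsP => n /=; rewrite addrA. Qed.
Lemma fps_addC : commutative fps_add.
Proof. by move=> f g; apply/fpsP => n /=; rewrite addrC. Qed.
Lemma fps_add0 : left_id (fpsC 0) fps_add.
Proof. by move=> f; apply/fpsP => n /=; rewrite if_same add0r. Qed.
Lemma fps_addN : left_inverse (fpsC 0) fps_opp fps_add.
Proof. by move=> f; apply/fpsP => n /=; rewrite if_same addNr. Qed.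

HB.instance Definition _ :=
  GRing.isZmodule.Build (fps F) fps_addA fps_addC fps_add0 fps_addN.

Definition fps_trunc n f : {poly F} := \poly_(i < n.+1) fcoef f i.

Lemma coef_fps_trunc n f i : (i <= n)%N -> (fps_trunc n f)`_i = fcoef f i.
Proof. by move=> le_in; rewrite coef_poly ltnS le_in. Qed.

Lemma fcoef_mul_trunc n f g i : (i <= n)%N ->
  fcoef (fps_mul f g) i = (fps_trunc n f * fps_trunc n g)`_i.
Proof.
move=> le_in; rewrite coefM /=; apply: eq_bigr => j _.
rewrite !coef_fps_trunc //; first exact: leq_trans (leq_subr _ _) le_in.
by apply: leq_trans le_in; rewrite -ltnS.
Qed.

Lemma fps_mulA : associative fps_mul.
Proof.
move=> f g h; apply/fpsP => n.
have e1 : fcoef (fps_mul f (fps_mul g h)) n =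
    (fps_trunc n f * (fps_trunc n g * fps_trunc n h))`_n.
  rewrite coefM /=; apply: eq_bigr => i _.
  rewrite coef_fps_trunc -1?ltnS //.
  by rewrite -(@fcoef_mul_trunc n) ?leq_subr.
have e2 : fcoef (fps_mul (fps_mul f g) h) n =
    ((fps_trunc n f * fps_trunc n g) * fps_trunc n h)`_n.
  rewrite coefM /=; apply: eq_bigr => i _.
  rewrite [in RHS]coef_fps_trunc ?leq_subr //.
  by rewrite -(@fcoef_mul_trunc n) // -ltnS.
by rewrite e1 e2 mulrA.
Qed.

Lemma fps_mulC : commutative fps_mul.
Proof.
by move=> f g; apply/fpsP => n; rewrite !(@fcoef_mul_trunc n) // mulrC.
Qed.

Lemma fps_mul1 : left_id (fpsC 1) fps_mul.
Proof.
move=> f; apply/fpsP => n /=.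
by rewrite big_ord_recl /= mul1r subn0 big1 ?addr0 // => i _; rewrite mul0r.
Qed.

Lemma fps_mulDl : left_distributive fps_mul fps_add.
Proof.
move=> f g h; apply/fpsP => n /=.
by rewrite -big_split; apply: eq_bigr => i _; rewrite mulrDl.
Qed.

Lemma fps_1_neq0 : fpsC 1 != 0.
Proof. by apply/eqP => /fpsP/(_ 0%N)/= /eqP; rewrite oner_eq0. Qed.

HB.instance Definition _ := GRing.Zmodule_isComNzRing.Build (fps F)
  fps_mulA fps_mulC fps_mul1 fps_mulDl fps_1_neq0.

Lemma fcoef0 n : fcoef (0 : fps F) n = 0.
Proof. exact: if_same. Qed.
Lemma fcoef1 n : fcoef (1 : fps F) n = if n == 0%N then 1 else 0.
Proof. by []. Qed.
Lemma fcoefD f g n : fcoef (f + g) n = fcoef f n + fcoef g n.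
Proof. by []. Qed.
Lemma fcoefN f n : fcoef (- f) n = - fcoef f n.
Proof. by []. Qed.
Lemma fcoefB f g n : fcoef (f - g) n = fcoef f n - fcoef g n.
Proof. by []. Qed.
Lemma fcoefM f g n :
  fcoef (f * g) n = \sum_(i < n.+1) fcoef f i * fcoef g (n - i)%N.
Proof. by []. Qed.
Lemma fcoef_sum (I : Type) (r : seq I) (P : pred I) (G : I -> fps F) n :
  fcoef (\sum_(i <- r | P i) G i) n = \sum_(i <- r | P i) fcoef (G i) n.
Proof.
apply: (big_morph (fun f => fcoef f n)) => //; exact: fcoef0.
Qed.

Lemma fcoefX_small f k n :
  fcoef f 0%N = 0 -> (n < k)%N -> fcoef (f ^+ k) n = 0.
Proof.
move=> f0; elim: k n => // k IHk n lt_nk.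
rewrite exprS fcoefM big_ord_recl /= f0 mul0r add0r big1 // => i _.
rewrite IHk ?mulr0 //.
rewrite /bump /= add1n; have lt_in := ltn_ord i.
apply: leq_trans (_ : n <= k)%N; last by rewrite -ltnS.
by rewrite ltn_subrL /=; apply: leq_ltn_trans lt_in.
Qed.

Definition fps_unit : {pred fps F} := fun f => fcoef f 0%N != 0.

(* 1 / f = f_0^-1 * \sum_k (1 - f / f_0)^k, where f_0 is the constant term; the
   k-th power has no term of degree less than k. *)
Definition fps_geom f : fps F :=
  Fps (fun n => \sum_(k < n.+1) fcoef (f ^+ k) n).
Definition fps_inv f : fps F :=
  if fcoef f 0%N == 0 then f
  else let c := fpsC (fcoef f 0%N)^-1 in c * fps_geom (1 - c * f).

Lemma fps_geomE f : fcoef f 0%N = 0 -> (1 - f) * fps_geom f = 1.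
Proof.
move=> f0; apply/fpsP => n.
have -> : fcoef ((1 - f) * fps_geom f) n =
    fcoef ((1 - f) * \sum_(k < n.+1) f ^+ k) n.
  rewrite !fcoefM; apply: eq_bigr => i _; congr (_ * _).
  rewrite fcoef_sum /= -(big_mkord xpredT (fun k => fcoef (f ^+ k) (n - i)%N)).
  rewrite -(big_mkord xpredT (fun k => fcoef (f ^+ k) (n - i)%N)).
  have le_n : ((n - i).+1 <= n.+1)%N by rewrite ltnS leq_subr.
  rewrite (big_cat_nat _ le_n) //= [X in _ = _ + X]big_nat_cond.
  by rewrite [X in _ = _ + X]big1 ?addr0 // => k /andP[/andP[lt_k _] _];
     rewrite fcoefX_small.
have -> : (1 - f) * \sum_(k < n.+1) f ^+ k = 1 - f ^+ n.+1.
  by rewrite -[in RHS](expr1n _ n.+1) subrXX; congr (_ * _);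
     apply: eq_bigr => i _; rewrite expr1n mul1r.
by rewrite fcoefB fcoefX_small // subr0.
Qed.

Lemma fcoefM0 f g : fcoef (f * g) 0%N = fcoef f 0%N * fcoef g 0%N.
Proof. by rewrite fcoefM big_ord_recl big_ord0 addr0. Qed.

Lemma fps_mulVf : {in fps_unit, left_inverse 1 fps_inv *%R}.
Proof.
move=> f; rewrite unfold_in => f0; rewrite /fps_inv (negbTE f0) /=.
set c := fpsC _; rewrite mulrAC -{1}[c * f](subKr 1) fps_geomE //.
by rewrite fcoefB fcoef1 fcoefM0 /= mulVf ?subrr.
Qed.

Lemma fps_unitP f g : g * f = 1 -> fps_unit f.
Proof.
move=> /fpsP/(_ 0%N); rewrite fcoefM0 /fps_unit.
by apply: contra_eq_neq => ->; rewrite mulr0 fcoef1 eq_sym oner_neq0.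
Qed.

Lemma fps_inv_out : {in [predC fps_unit], fps_inv =1 id}.
Proof.
by move=> f; rewrite inE /= unfold_in negbK /fps_inv => ->.
Qed.

HB.instance Definition _ := GRing.ComNzRing_hasMulInverse.Build (fps F)
  fps_mulVf fps_unitP fps_inv_out.

Definition fpsX : fps F := Fps (fun n => if n == 1%N then 1 else 0).

(* f(q^p) *)
Definition fps_subX (p : nat) f : fps F :=
  Fps (fun n => if (p %| n)%N then fcoef f (n %/ p)%N else 0).

(* f / q^p, for f divisible by q^p *)
Definition fps_divXn (p : nat) f : fps F := Fps (fun n => fcoef f (n + p)%N).

(* log f = \sum_(k >= 1) (-1)^(k+1) (f - 1)^k / k, for f with constant term 1
   and F of characteristic 0; (f - 1)^k has no term of degree less than k. *)
Definition fps_log f : fps F :=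
  Fps (fun n =>
    \sum_(1 <= k < n.+1) (-1) ^+ k.+1 / k%:R * fcoef ((f - 1) ^+ k) n).

(* The infinite product of the G n, n >= 1, for G n in 1 + q^n F[[q]]: only the
   factors G 1, ..., G N contribute to the coefficient of q^N, see
   fps_prod_stable. *)
Definition fps_prod (G : nat -> fps F) : fps F :=
  Fps (fun N => fcoef (\prod_(1 <= n < N.+1) G n) N).

Lemma fps_prod_stable (G : nat -> fps F) (N M : nat) :
    (forall n i, (0 < n)%N -> (i < n)%N ->
       fcoef (G n) i = fcoef (1 : fps F) i) ->
    (N <= M)%N ->
  fcoef (\prod_(1 <= n < M.+1) G n) N = fcoef (fps_prod G) N.
Proof.
move=> G1 /subnK <-; elim: (M - N)%N => // d IHd.
rewrite addSn big_nat_recr //= -[RHS]IHd -[in RHS](mulr1 (\prod_(_ <= _ < _) _)).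
rewrite !fcoefM; apply: eq_bigr => i _; rewrite G1 //.
by rewrite ltnS (leq_trans (leq_subr _ _)) ?leq_addl.
Qed.

(* x (x + 1) ... (x + n - 1) *)
Definition rising (x : F) (n : nat) : F := \prod_(i < n) (x + i%:R).

(* 2F1(a, b; c; z), for c not a nonpositive integer *)
Definition hyp2F1 (a b c : F) : fps F :=
  Fps (fun n => rising a n * rising b n / rising c n / n`!%:R).

End FpsRing.

Definition A (n : nat) : rat :=
  27%:R ^+ n * fcoef (hyp2F1 (1 / 3%:R) (1 / 3%:R) 1 ^+ 3 : fps rat) n.

(* The Legendre symbol (n/p), for p an odd prime *)
Definition legendre (n p : nat) : rat :=
  if (p %| n)%N then 0
  else if [exists x : 'I_p, (x ^ 2 == n %[mod p])%N] then 1 else -1.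

Definition chi3 (n : nat) : rat := legendre n 3.

Definition c (n : nat) : rat :=
  3%:R * \sum_(d <- divisors n) chi3 d * d%:R ^+ 4.

Definition Cq : fps rat := Fps (fun n => if n == 0%N then 1 else c n).

Definition tq : fps rat :=
  fpsX rat *
  fps_prod (fun n =>
    (1 - fpsX rat ^+ (3 * n)) ^+ 12 * (1 - fpsX rat ^+ n) ^- 12).

(* Both t(q)^p and t(q^p) are of the form q^p * (1 + ...), so the factor q^p is
   cancelled from the quotient t(q)^p / t(q^p) before dividing in rat[[q]]. *)
Definition U (p : nat) : fps rat :=
  fps_log (fps_divXn p (tq ^+ p) / fps_divXn p (fps_subX p tq)).

Definition Zloc (p : nat) (x : rat) : bool := ~~ (p %| `|denq x|)%N.

(* x = y mod p^k, i.e. x - y \in p^k Z_(p), for p prime *)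
Definition congp (p k : nat) (x y : rat) : Prop :=
  exists2 z : rat, Zloc p z & x - y = (p ^ k)%:R * z.

(* Main.v *)
From HB Require Import structures.
Require Import Defs.
From mathcomp Require Import all_boot all_order all_algebra.
From mathcomp Require Import zify ring boolp.

Set Implicit Arguments.
Unset Strict Implicit.
Unset Printing Implicit Defensive.

Import Order.TTheory GRing.Theory Num.Theory.
Local Open Scope ring_scope.

(* The cubic theta functions of the Borweins satisfy 2F1(1/3,1/3;1;-27t) = b, hence
   b^3 = \sum_n (-1)^n A_n t^n, and q t'/t = a^2, C = a^2 b^3.  Taking residues,
   (-1)^n A_n = [q^0] C t^{-n}.  Since t(q)^{-mp} = t(q^p)^{-m} exp(-m U_p) and p
   divides U_p, modulo p^4 only the powers U_p^l with l <= 3 matter; those with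
   l >= 1 contribute 0 by hypothesis, and the one with l = 0 gives (-1)^m A_m because
   c_{np} = c_n mod p^4.

   The modular identities are reduced to identities between Lambert series.  Seven
   instances of Liouville's elementary identity for sums over ax + by = n determine
   the q-derivatives of the Eisenstein series involved, and eliminating the
   unwanted series from the resulting system yields C = a^2 b^3 together with
   Ramanujan-type differential equations.  The latter turn the hypergeometric
   equation into a first-order equation with a unique solution. *)

(** * Liouville's identity *)

(** Finite-dimensionality of spaces of modular forms would be the usual source of C = a^2 b^3;
    linear algebra over Lambert series replaces it. The obstacle is that each instance of
    Liouville's identity that yields a derivative expresses that of a series with exponent j through
    products and the series with exponent j + 2, so these instances alone never close up. The way
    out is that [k3 d + 1] is 3 on multiples of 3 and 0 elsewhere: the series of odd exponent
    twisted by [k3] become combinations of E_2, E_4, E_6 at q and at q^3, and Ramanujan's equations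
    at both arguments supply the missing relations. The theta functions never occur as lattice sums:
    a and b^3 are Lambert series, and b itself occurs only as the hypergeometric series in t. Since
    t has no constant term, t^-n is not a power series. With [tau] = t/q, the coefficient of q^0 in
    C t^-n is read as that of q^n in C [tau]^-n. *)

Lemma big_bij (V : nmodType) (T1 T2 : eqType) (s : seq T1) (t : seq T2)
    (phi : T1 -> T2) (psi : T2 -> T1) (F : T2 -> V) :
    uniq s -> uniq t ->
    {in s, forall u, phi u \in t /\ psi (phi u) = u} ->
    {in t, forall v, psi v \in s /\ phi (psi v) = v} ->
  \sum_(v <- t) F v = \sum_(u <- s) F (phi u).
Proof.
move=> us ut st ts; rewrite -(big_map phi xpredT F).
apply: perm_big; apply: uniq_perm => //.
  rewrite map_inj_in_uniq // => u v /st[_ {2}<-] /st[_ {2}<-] -> //.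
move=> v; apply/idP/mapP => [/ts[sv <-]|[u /st[tu _] -> //]].
by exists (psi v) => //; have [] := ts v.
Qed.

(** Bounding all four entries by n loses no positive solution of a x + b y = n, since each entry is
    at most a x + b y. *)
Definition quads (n : nat) : seq (nat * nat * (nat * nat)) :=
  let r := iota 1 n in let rr := [seq (i, j) | i <- r, j <- r] in
  locked [seq u <- [seq (v, w) | v <- rr, w <- rr] |
    (u.1.1 * u.2.1 + u.1.2 * u.2.2 == n)%N].

Lemma mem_quads n a b x y :
  ((a, b, (x, y)) \in quads n) =
  [&& 0 < a, 0 < b, 0 < x, 0 < y & a * x + b * y == n]%N.
Proof.
rewrite /quads -lock mem_filter /= andbC.
case: eqP => [<-|_]; last by rewrite !andbF.
rewrite !andbT.
have mr i j (r : seq nat) :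
    ((i, j) \in [seq (i, j) | i <- r, j <- r]) = (i \in r) && (j \in r).
  by apply/allpairsP/andP => [[[i' j'] /= [? ? [-> ->]]] //|[? ?]]; exists (i, j).
set s := iota 1 _.
have -> : ((a, b, (x, y)) \in [seq (v, w) | v <- [seq (i, j) | i <- s, j <- s],
    w <- [seq (i, j) | i <- s, j <- s]]) =
    ((a \in s) && (b \in s)) && ((x \in s) && (y \in s)).
  rewrite -!mr; apply/allpairsP/andP => [[[v w] /= [? ? [-> ->]]] //|[? ?]].
  by exists ((a, b), (x, y)).
rewrite !mem_iota {s mr}; apply/idP/idP; first by lia.
by case/and4P; nia.
Qed.

Lemma quads_uniq n : uniq (quads n).
Proof.
have ur : uniq [seq (i, j) | i <- iota 1 n, j <- iota 1 n].
  by apply: allpairs_uniq; rewrite ?iota_uniq // => -[? ?] [? ?].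
by rewrite /quads -lock; apply: filter_uniq; apply: allpairs_uniq => // -[? ?] [? ?].
Qed.

Lemma big_quads_bij (V : nmodType) n (P Q : pred (nat * nat * (nat * nat)))
    (phi psi : nat * nat * (nat * nat) -> nat * nat * (nat * nat))
    (F : nat * nat * (nat * nat) -> V) :
    (forall a b x y, (a, b, (x, y)) \in quads n -> P (a, b, (x, y)) ->
      [/\ phi (a, b, (x, y)) \in quads n, Q (phi (a, b, (x, y))) &
          psi (phi (a, b, (x, y))) = (a, b, (x, y))]) ->
    (forall a b x y, (a, b, (x, y)) \in quads n -> Q (a, b, (x, y)) ->
      [/\ psi (a, b, (x, y)) \in quads n, P (psi (a, b, (x, y))) &
          phi (psi (a, b, (x, y))) = (a, b, (x, y))]) ->
  \sum_(v <- quads n | Q v) F v = \sum_(u <- quads n | P u) F (phi u).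
Proof.
move=> PQ QP; rewrite -[LHS]big_filter -[RHS]big_filter.
apply: (big_bij (psi := psi)); rewrite ?filter_uniq ?quads_uniq //.
- move=> [[a b] [x y]]; rewrite !mem_filter => /andP[Pu u].
  by have [-> -> ->] := PQ _ _ _ _ u Pu.
- move=> [[a b] [x y]]; rewrite !mem_filter => /andP[Qu u].
  by have [-> -> ->] := QP _ _ _ _ u Qu.
Qed.

(** Serves both diagonals of Liouville's identity: solutions with a = b are given by the divisor d =
    a and l = x < n/d, those with x = y by the divisor d = a + b and l = a < d. *)
Lemma big_quads_divisors (V : nmodType) n (Q : pred (nat * nat * (nat * nat)))
    (phi : nat * nat -> nat * nat * (nat * nat))
    (psi : nat * nat * (nat * nat) -> nat * nat) (r : nat -> nat)
    (F : nat * nat * (nat * nat) -> V) : (0 < n)%N ->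
    (forall d l, (d %| n)%N -> (0 < l < r d)%N ->
      [/\ phi (d, l) \in quads n, Q (phi (d, l)) & psi (phi (d, l)) = (d, l)]) ->
    (forall a b x y, (a, b, (x, y)) \in quads n -> Q (a, b, (x, y)) ->
      [/\ (psi (a, b, (x, y))).1 %| n,
          0 < (psi (a, b, (x, y))).2 < r (psi (a, b, (x, y))).1 &
          phi (psi (a, b, (x, y))) = (a, b, (x, y))]%N) ->
  \sum_(v <- quads n | Q v) F v =
  \sum_(d <- divisors n) \sum_(1 <= l < r d) F (phi (d, l)).
Proof.
move=> n0 PQ QP; rewrite -[LHS]big_filter.
rewrite -(big_allpairs_dep (I2 := fun=> nat) (h := fun d l : nat => (d, l)) (r1 :=
  divisors n)
  (r2 := fun d => index_iota 1 (r d)) (F := fun u => F (phi u))).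
apply: (big_bij (psi := psi)); rewrite ?filter_uniq ?quads_uniq //.
- apply: allpairs_uniq_dep; first exact: divisors_uniq; first move=> d _.
    exact: iota_uniq.
  by move=> [? ?] [? ?] _ _ /= [-> ->].
- move=> u /allpairsPdep[d [l [/= dn lr ->]]]; rewrite mem_filter.
  move: dn lr; rewrite -dvdn_divisors // mem_index_iota => dn lr.
  by have [-> -> ->] := PQ _ _ dn lr.
- move=> [[a b] [x y]]; rewrite mem_filter => /andP[Qu u].
  have [dn lr e] := QP _ _ _ _ u Qu; split=> //.
  apply/allpairsPdep; exists (psi (a, b, (x, y))).1, (psi (a, b, (x, y))).2.
  by rewrite -surjective_pairing -dvdn_divisors // mem_index_iota.
Qed.

Lemma dvdnE_div n d : (0 < n)%N -> (d %| n)%N ->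
  [/\ 0 < d, 0 < n %/ d & (n %/ d) * d = n]%N.
Proof.
move=> n0 dn; have d0 := dvdn_gt0 n0 dn; split=> //; last exact: divnK.
by rewrite divn_gt0 // dvdn_leq.
Qed.

Lemma dvdn_div_eq n a x : (0 < a)%N -> (a * x = n)%N -> (n %/ a = x)%N.
Proof. by move=> a0 <-; rewrite mulKn. Qed.

Lemma sum_quads_eq_fst (V : nmodType) n (F : nat -> nat -> V) : (0 < n)%N ->
  \sum_(u <- quads n | u.1.1 == u.1.2) F u.1.1 u.1.2 =
  \sum_(d <- divisors n) F d d *+ (n %/ d).-1.
Proof.
move=> n0; rewrite (big_quads_divisors (r := fun d => (n %/ d)%N)
  (phi := fun v => (v.1, v.1, (v.2, n %/ v.1 - v.2)%N))
  (psi := fun u => (u.1.1, u.2.1))) //=.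
- by apply: eq_bigr => d _; rewrite sumr_const_nat subn1.
- move=> d l dn l_lt; have [d0 nd0 e] := dvdnE_div n0 dn.
  by rewrite mem_quads; split=> //; nia.
- move=> a b x y; rewrite mem_quads /= => /and5P[a0 b0 x0 y0 /eqP e] /eqP ab.
  subst b; have e' : (a * (x + y) = n)%N by lia.
  rewrite (dvdn_div_eq a0 e') -e' dvdn_mulr //; split=> //; first lia.
  by congr (_, (_, _)); lia.
Qed.

Lemma sum_quads_eq_snd (V : nmodType) n (F : nat -> nat -> V) : (0 < n)%N ->
  \sum_(u <- quads n | u.2.1 == u.2.2) F u.1.1 u.1.2 =
  \sum_(d <- divisors n) \sum_(1 <= l < d) F l (d - l)%N.
Proof.
move=> n0; rewrite (big_quads_divisors (r := id)
  (phi := fun v => (v.2, v.1 - v.2, (n %/ v.1, n %/ v.1))%N)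
  (psi := fun u => (u.1.1 + u.1.2, u.1.1)%N)) //=.
- move=> d l dn l_lt; have [d0 nd0 e] := dvdnE_div n0 dn.
  by rewrite mem_quads; split=> //; [nia | congr (_, _); lia].
- move=> a b x y; rewrite mem_quads /= => /and5P[a0 b0 x0 y0 /eqP e] /eqP xy.
  subst y; have e' : ((a + b) * x = n)%N by lia.
  rewrite (dvdn_div_eq _ e') ?addn_gt0 ?a0 // -e' dvdn_mulr //; split=> //; first lia.
  by congr (_, _, _); lia.
Qed.

Lemma big_split3 (V : nmodType) (T : Type) (s : seq T) (g h : T -> nat) (F : T -> V) :
  \sum_(u <- s) F u = \sum_(u <- s | (g u < h u)%N) F u +
    \sum_(u <- s | (g u == h u)%N) F u + \sum_(u <- s | (h u < g u)%N) F u.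
Proof.
rewrite (bigID (fun u => g u < h u)%N) /= -addrA; congr (_ + _).
rewrite (bigID (fun u => g u == h u)%N) /=; congr (_ + _).
  by apply: eq_bigl => u; lia.
by apply: eq_bigl => u; lia.
Qed.

Lemma sum_quads_swap (V : nmodType) n (P : pred (nat * nat * (nat * nat)))
    (F : nat * nat * (nat * nat) -> V) :
  \sum_(u <- quads n | P u) F u =
  \sum_(u <- quads n | P (u.1.2, u.1.1, (u.2.2, u.2.1)))
     F (u.1.2, u.1.1, (u.2.2, u.2.1)).
Proof.
apply: (big_quads_bij (psi := fun u => (u.1.2, u.1.1, (u.2.2, u.2.1)))) => a b x y;
  by rewrite !mem_quads /= => ? ?; split=> //; lia.
Qed.

(* Liouville's identity: [(a, b, x, y) |-> (a + b, b, x, y - x)] and its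
   analogues trade the order of [a, b] for the order of [x, y], so that only the
   diagonals [a = b] and [x = y] survive. *)
Lemma Liouville (V : comPzRingType) n (f : nat -> V) : (0 < n)%N ->
  \sum_(u <- quads n) (f (u.1.1 - u.1.2 + (u.1.2 - u.1.1))%N - f (u.1.1 + u.1.2)%N) =
  \sum_(d <- divisors n) (f d *+ (n %/ d).-1 *+ 2 + f 0%N *+ (n %/ d).-1 -
     f d *+ d.-1 - (\sum_(1 <= l < d) f l) *+ 2).
Proof.
move=> n0.
set Tlt := \sum_(u <- quads n | (u.2.1 < u.2.2)%N) f u.1.1.
set Tgt := \sum_(u <- quads n | (u.1.2 < u.1.1)%N) f u.1.1.
set Ea := \sum_(u <- quads n | u.1.1 == u.1.2) f u.1.1.
set Ex := \sum_(u <- quads n | u.2.1 == u.2.2) f u.1.1.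
(* The sum of f a over all solutions is split in two ways, by comparing x with y and a with b. The
   shear used here keeps a and carries x > y onto a < b, so these two parts cancel. *)
have cut : Tlt + Ex = Tgt + Ea.
  have := big_split3 (quads n) (fun u => u.2.1) (fun u => u.2.2) (fun u => f u.1.1).
  rewrite (big_split3 (quads n) (fun u => u.1.2) (fun u => u.1.1)) -/Tlt -/Ex -/Tgt.
  rewrite (@big_quads_bij _ n (fun u => u.2.2 < u.2.1)%N (fun u => u.1.1 < u.1.2)%N
    (fun u => (u.1.1, u.1.1 + u.1.2, (u.2.1 - u.2.2, u.2.2)))%N
    (fun u => (u.1.1, u.1.2 - u.1.1, (u.2.1 + u.2.2, u.2.2)))%N); first last.
  - by move=> a b x y; rewrite !mem_quads /= => ? ?; split; [nia|lia|];
       congr (_, _, (_, _)); lia.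
  - by move=> a b x y; rewrite !mem_quads /= => ? ?; split; [nia|lia|];
       congr (_, _, (_, _)); lia.
  move=> /addIr <-; congr (_ + _).
  by apply: eq_bigl => u; rewrite eq_sym.
have difflt : \sum_(u <- quads n | (u.1.2 < u.1.1)%N)
    f (u.1.1 - u.1.2 + (u.1.2 - u.1.1))%N = Tlt.
  rewrite /Tlt (@big_quads_bij _ n (fun u => u.1.2 < u.1.1)%N (fun u => u.2.1 < u.2.2)%N
    (fun u => (u.1.1 - u.1.2, u.1.2, (u.2.1, u.2.1 + u.2.2)))%N
    (fun u => (u.1.1 + u.1.2, u.1.2, (u.2.1, u.2.2 - u.2.1)))%N).
  - by apply: eq_bigr => -[[a b] [x y]] /= ?; congr f; lia.
  - by move=> a b x y; rewrite !mem_quads /= => ? ?; split; [nia|lia|];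
       congr (_, _, (_, _)); lia.
  - by move=> a b x y; rewrite !mem_quads /= => ? ?; split; [nia|lia|];
       congr (_, _, (_, _)); lia.
have diffgt : \sum_(u <- quads n | (u.1.1 < u.1.2)%N)
    f (u.1.1 - u.1.2 + (u.1.2 - u.1.1))%N = Tlt.
  rewrite sum_quads_swap /= -difflt; apply: eq_bigr => u _.
  by rewrite addnC.
have sumlt : \sum_(u <- quads n | (u.2.1 < u.2.2)%N) f (u.1.1 + u.1.2)%N = Tgt.
  rewrite /Tgt (@big_quads_bij _ n (fun u => u.2.1 < u.2.2)%N (fun u => u.1.2 < u.1.1)%N
    (fun u => (u.1.1 + u.1.2, u.1.2, (u.2.1, u.2.2 - u.2.1)))%N
    (fun u => (u.1.1 - u.1.2, u.1.2, (u.2.1, u.2.1 + u.2.2)))%N) //.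
  - by move=> a b x y; rewrite !mem_quads /= => ? ?; split; [nia|lia|];
       congr (_, _, (_, _)); lia.
  - by move=> a b x y; rewrite !mem_quads /= => ? ?; split; [nia|lia|];
       congr (_, _, (_, _)); lia.
have sumgt : \sum_(u <- quads n | (u.2.2 < u.2.1)%N) f (u.1.1 + u.1.2)%N = Tgt.
  rewrite sum_quads_swap /= -sumlt; apply: eq_bigr => u _.
  by rewrite addnC.
rewrite sumrB (big_split3 _ (fun u => u.1.2) (fun u => u.1.1)) /= difflt diffgt.
rewrite (big_split3 _ (fun u => u.2.1) (fun u => u.2.2)) /= sumlt sumgt.
have -> : \sum_(u <- quads n | u.1.2 == u.1.1) f (u.1.1 - u.1.2 + (u.1.2 - u.1.1))%N =
    \sum_(d <- divisors n) f 0%N *+ (n %/ d).-1.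
  rewrite -(sum_quads_eq_fst (fun _ _ => f 0%N)) //.
  rewrite (eq_bigl (fun u => u.1.1 == u.1.2)) => [|u]; last by rewrite eq_sym.
  by apply: eq_bigr => u /eqP ->; rewrite subnn.
rewrite (sum_quads_eq_snd (fun a b => f (a + b)%N)) //.
have -> : \sum_(d <- divisors n) \sum_(1 <= l < d) f (l + (d - l))%N =
    \sum_(d <- divisors n) f d *+ d.-1.
  apply: eq_bigr => d _; rewrite -subn1 -sumr_const_nat.
  by apply: eq_big_nat => l ?; congr f; lia.
have eEa : Ea = \sum_(d <- divisors n) f d *+ (n %/ d).-1.
  exact: (sum_quads_eq_fst (fun a _ => f a)).
have eEx : Ex = \sum_(d <- divisors n) \sum_(1 <= l < d) f l.
  exact: (sum_quads_eq_snd (fun a _ => f a)).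
rewrite !sumrB big_split /= !sumrMnl -eEa -eEx.
have -> : Tlt = Tgt + Ea - Ex by rewrite -cut addrK.
rewrite !mulr2n !opprD.
set u := \sum_(d <- _) _; set v := \sum_(d <- _) _.
ring.
Qed.

(** * Formal power series *)

Section FpsTheory.
Variable F : fieldType.
Implicit Types f g h : fps F.

Lemma fcoef_mulrn f k n : fcoef (f *+ k) n = fcoef f n *+ k.
Proof. by elim: k => [|k IHk]; rewrite ?fcoef0 // !mulrS fcoefD IHk. Qed.

Lemma fcoef_natl k f n : fcoef (k%:R * f) n = k%:R * fcoef f n.
Proof. by rewrite !mulr_natl fcoef_mulrn. Qed.

(** The Euler operator q d/dq. *)
Definition theta f : fps F := locked (Fps (fun n => n%:R * fcoef f n)).

Lemma fcoef_theta f n : fcoef (theta f) n = n%:R * fcoef f n.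
Proof. by rewrite /theta -lock. Qed.
Lemma thetaD f g : theta (f + g) = theta f + theta g.
Proof. by apply/fpsP => n; rewrite fcoefD !fcoef_theta mulrDr. Qed.
Lemma thetaN f : theta (- f) = - theta f.
Proof. by apply/fpsP => n; rewrite fcoefN !fcoef_theta mulrN. Qed.
Lemma thetaM f g : theta (f * g) = theta f * g + f * theta g.
Proof.
apply/fpsP => n; rewrite fcoefD !fcoefM fcoef_theta fcoefM mulr_sumr -big_split /=.
apply: eq_bigr => i _; have le_in : (i <= n)%N by rewrite -ltnS.
by rewrite !fcoef_theta -{1}(subnKC le_in) natrD; move: (n - i)%N (nat_of_ord i) => j
  k; ring.
Qed.
Lemma theta1 : theta 1 = 0.
Proof. by apply/fpsP => -[|n]; rewrite fcoef_theta ?fcoef0 ?mul0r ?mulr0. Qed.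
Lemma thetaX f k : theta (f ^+ k.+1) = k.+1%:R * f ^+ k * theta f.
Proof.
elim: k => [|k IHk]; first by rewrite expr0 expr1 !mul1r.
by rewrite exprS thetaM IHk (mulrSr 1 k.+1) !exprS; ring.
Qed.
Lemma thetaMn k f : theta (k%:R * f) = k%:R * theta f.
Proof. by apply/fpsP => n; rewrite fcoef_theta !fcoef_natl fcoef_theta mulrCA. Qed.
Lemma theta_nat k : theta k%:R = 0.
Proof. by rewrite -[k%:R]mulr1 thetaMn theta1 mulr0. Qed.

Lemma fps_unitE f : (f \is a GRing.unit) = (fcoef f 0%N != 0).
Proof. by []. Qed.

Lemma fcoefM_eq0 f g n : (forall i, (i < n)%N -> fcoef g i = 0) ->
  fcoef (f * g) n = fcoef f 0%N * fcoef g n.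
Proof.
move=> g0; rewrite fcoefM big_ord_recl subn0 big1 ?addr0 // => i _ /=.
by rewrite g0 ?mulr0 // /bump /= add1n ltn_subrL; case: n g0 i => [_ []|].
Qed.

End FpsTheory.

Section SubX.
Variables (F : fieldType) (p : nat).
Hypothesis p0 : (0 < p)%N.
Implicit Types f g h : fps F.

Lemma fcoef_subX f n :
  fcoef (fps_subX p f) n = if (p %| n)%N then fcoef f (n %/ p)%N else 0.
Proof. by []. Qed.
Lemma fps_subXD f g : fps_subX p (f + g) = fps_subX p f + fps_subX p g.
Proof. by apply/fpsP => n; rewrite fcoefD /=; case: ifP; rewrite ?addr0. Qed.

Lemma fps_subXN f : fps_subX p (- f) = - fps_subX p f.
Proof. by apply/fpsP => n; rewrite fcoefN /=; case: ifP; rewrite ?oppr0. Qed.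

Lemma fps_subX1 : fps_subX p (1 : fps F) = 1.
Proof.
apply/fpsP => -[|n]; first by rewrite /= dvdn0 div0n.
rewrite /=; case: ifP => // /dvdnP[[|k] e]; first by lia.
by rewrite e mulnK.
Qed.

Lemma fcoefM_subX f g n :
  fcoef (fps_subX p f * g) n =
  \sum_(0 <= i < (n %/ p).+1) fcoef f i * fcoef g (n - i * p)%N.
Proof.
rewrite fcoefM -(big_mkord xpredT (fun i => fcoef (fps_subX p f) i * fcoef g (n - i)%N)).
rewrite (bigID (fun i => p %| i)%N) /= [X in _ + X]big1 ?addr0; last first.
  by move=> i /negbTE ->; rewrite mul0r.
rewrite -big_filter (big_bij (s := index_iota 0 (n %/ p).+1)
  (phi := fun i => (i * p)%N) (psi := fun i => (i %/ p)%N)) ?filter_uniq ?iota_uniq //.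
- by apply: eq_bigr => i _; rewrite dvdn_mull // mulnK.
- move=> i; rewrite mem_filter !mem_index_iota /= !ltnS leq_divRL // => i_le.
  by rewrite dvdn_mull // mulnK.
- move=> i; rewrite mem_filter !mem_index_iota /= !ltnS => /andP[pi i_le].
  by rewrite leq_div2r // divnK.
Qed.

Lemma fps_subXM f g : fps_subX p (f * g) = fps_subX p f * fps_subX p g.
Proof.
apply/fpsP => n; rewrite fcoefM_subX fcoef_subX; case: ifP => pn.
  rewrite fcoefM -(big_mkord xpredT (fun i => fcoef f i * fcoef g (n %/ p - i)%N)).
  apply: eq_big_nat => i i_lt; have le_i : (i * p <= n)%N.
    by rewrite -leq_divRL //; lia.
  by rewrite fcoef_subX dvdn_sub ?dvdn_mull // divnBr ?dvdn_mull ?mulnK.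
rewrite big1_seq // => i; rewrite andTb mem_index_iota => i_lt.
have le_i : (i * p <= n)%N by rewrite -leq_divRL //; lia.
by rewrite fcoef_subX dvdn_subl ?dvdn_mull // pn mulr0.
Qed.

Lemma fps_subX_nat k : fps_subX p (k%:R : fps F) = k%:R.
Proof.
elim: k => [|k IHk]; last by rewrite !mulrS fps_subXD fps_subX1 IHk.
by rewrite -[0%:R](subrr 1) fps_subXD fps_subXN fps_subX1.
Qed.

Lemma theta_subX f : theta (fps_subX p f) = p%:R * fps_subX p (theta f).
Proof.
apply/fpsP => n; rewrite fcoef_natl fcoef_theta !fcoef_subX; case: ifP => pn; last by
  rewrite !mulr0.
by rewrite fcoef_theta mulrA -natrM mulnC divnK.
Qed.

End SubX.

Lemma fps_natl_inj (k : nat) (f g : fps rat) :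
  (0 < k)%N -> k%:R * f = k%:R * g -> f = g.
Proof.
move=> k0 /fpsP e; apply/fpsP => n; have := e n; rewrite !fcoef_natl.
by apply: mulfI; rewrite pnatr_eq0 -lt0n.
Qed.

(** * Lambert series *)

Lemma chi3E n :
  chi3 n = if (n %% 3 == 0)%N then 0 else if (n %% 3 == 1)%N then 1 else -1.
Proof.
rewrite /chi3 /legendre /dvdn; case: eqP => // n3.
have : (n %% 3 < 3)%N by rewrite ltn_pmod.
case: ifP => [/existsP[x /eqP e]|/negbT].
  by move: n3; rewrite -{}e; case: x => -[|[|[|]]].
rewrite negb_exists => /forallP/(_ 1)/=.
by case: (n %% 3)%N n3 => [|[|[|]]].
Qed.

(* [2 cos (2 pi n / 3)]; likewise [chi3 n] is [2 / sqrt 3 * sin (2 pi n / 3)]. *)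
Definition k3 (n : nat) : rat := if (n %% 3 == 0)%N then 2 else -1.

(** With [chi3] and [k3] read as sine and cosine, this and the next three lemmas are the addition
    formulas. *)
Lemma chi3D a b : chi3 (a + b) = (chi3 a * k3 b + k3 a * chi3 b) / 2.
Proof.
rewrite !chi3E /k3 -modnDm; have := @ltn_pmod a 3 isT; have := @ltn_pmod b 3 isT.
by case: (a %% 3)%N => [|[|[|]]] //; case: (b %% 3)%N => [|[|[|]]].
Qed.

Lemma k3D a b : k3 (a + b) = (k3 a * k3 b - 3 * chi3 a * chi3 b) / 2.
Proof.
rewrite !chi3E /k3 -modnDm; have := @ltn_pmod a 3 isT; have := @ltn_pmod b 3 isT.
by case: (a %% 3)%N => [|[|[|]]] //; case: (b %% 3)%N => [|[|[|]]].
Qed.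

Lemma chi3B a b : (b <= a)%N -> chi3 (a - b) = (chi3 a * k3 b - k3 a * chi3 b) / 2.
Proof.
move=> /subnK; set c := (a - b)%N => <-.
rewrite chi3D k3D !chi3E /k3; have := @ltn_pmod c 3 isT; have := @ltn_pmod b 3 isT.
by case: (c %% 3)%N => [|[|[|]]] //; case: (b %% 3)%N => [|[|[|]]].
Qed.

Lemma k3B a b : (b <= a)%N -> k3 (a - b) = (k3 a * k3 b + 3 * chi3 a * chi3 b) / 2.
Proof.
move=> /subnK; set c := (a - b)%N => <-.
rewrite chi3D k3D !chi3E /k3; have := @ltn_pmod c 3 isT; have := @ltn_pmod b 3 isT.
by case: (c %% 3)%N => [|[|[|]]] //; case: (b %% 3)%N => [|[|[|]]].
Qed.

Definition lam (f : nat -> rat) : fps rat :=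
  
  locked (Fps (fun n => if n == 0%N then 0 else \sum_(d <- divisors n) f d)).

Lemma fcoef_lam f n : (0 < n)%N -> fcoef (lam f) n = \sum_(d <- divisors n) f d.
Proof. by rewrite /lam -lock; case: n. Qed.
Lemma fcoef_lam0 f : fcoef (lam f) 0%N = 0.
Proof. by rewrite /lam -lock. Qed.

(** A divisor a of i with cofactor x and a divisor b of n - i with cofactor y are the same thing as
    a solution of a x + b y = n. *)
Lemma lamM f g n : fcoef (lam f * lam g) n =
  \sum_(u <- quads n) f u.1.1 * g u.1.2.
Proof.
rewrite fcoefM -(big_mkord xpredT (fun i => fcoef (lam f) i * fcoef (lam g) (n - i)%N)).
rewrite (bigID (fun i => 0 < i < n)%N) /= [X in _ + X]big1 ?addr0; last first.
  move=> i; rewrite negb_and -!leqNgt leqn0 => /orP[/eqP ->|]; first by rewrite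
    fcoef_lam0 mul0r.
  by rewrite -subn_eq0 => /eqP ->; rewrite fcoef_lam0 mulr0.
rewrite -big_filter; set s0 := [seq _ <- _ | _].
have us0 : uniq s0 by rewrite filter_uniq ?iota_uniq.
have ms0 i : (i \in s0) = (0 < i < n)%N.
  by rewrite mem_filter mem_index_iota; lia.
pose s1 := [seq (i, d) | i <- s0, d <- divisors i].
pose s2 := [seq (v, e) | v <- s1, e <- divisors (n - v.1)].
transitivity (\sum_(w <- s2) f w.1.2 * g w.2).
  rewrite /s2 (big_allpairs_dep (I2 := fun=> nat) (h := fun v e => (v, e))
    (r2 := fun v => divisors (n - v.1))) /=.
  rewrite /s1 (big_allpairs_dep (I2 := fun=> nat) (h := fun i d : nat => (i, d))
    (r2 := fun i => divisors i)) /=.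
  apply: eq_big_seq => i; rewrite ms0 => /andP[i0 i_lt].
  rewrite !fcoef_lam ?subn_gt0 // mulr_suml; apply: eq_bigr => d _.
  by rewrite mulr_sumr.
rewrite (@big_bij _ _ _ (quads n) s2
   (fun u => ((u.1.1 * u.2.1, u.1.1), u.1.2)%N)
   (fun w => (w.1.2, w.2, (w.1.1 %/ w.1.2, (n - w.1.1) %/ w.2))%N)) //.
- exact: quads_uniq.
- apply: allpairs_uniq_dep => [|v _|[? ?] [? ?] _ _ /= [-> ->] //].
    apply: allpairs_uniq_dep => [|v _|[? ?] [? ?] _ _ /= [-> ->] //] //.
    exact: divisors_uniq.
  exact: divisors_uniq.
- move=> [[a b] [x y]]; rewrite mem_quads => /and5P[a0 b0 x0 y0 /eqP e] /=.
  split; last by rewrite mulKn // -e addKn mulKn.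
  apply/allpairsPdep; exists (a * x, a)%N, b; split=> //=.
    apply/allpairsPdep; exists (a * x)%N, a; split=> //; first by rewrite ms0; nia.
    by rewrite -dvdn_divisors ?dvdn_mulr // muln_gt0 a0.
  by rewrite -e addKn -dvdn_divisors ?dvdn_mulr // muln_gt0 b0.
- move=> [[i d] e] /allpairsPdep[v [e' [/= + + [ev ->]]]]; rewrite -{}ev {v}.
  move=> /allpairsPdep[i1 [d1 [+ + [-> ->]]]]; rewrite ms0 => /andP[i0 i_lt] /=.
  have ni0 : (0 < n - i1)%N by rewrite subn_gt0.
  rewrite -!dvdn_divisors // => dd ee.
  have [? ? e1] := dvdnE_div i0 dd; have [? ? e2] := dvdnE_div ni0 ee.
  split; last by congr (_, _, _); lia.
  by rewrite mem_quads; lia.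
Qed.

(** On the diagonals, 2 (n/d) f d equals 2 n g d and gives the derivative of [lam g]; all that
    depends on d alone is gathered in [h]. Here [G d] is the closed form of f 1 + ... + f (d -
    1). *)
Lemma Liouville_lam (f g G h : nat -> rat) (H : nat -> nat -> rat) n :
    (forall d, f d = d%:R * g d) ->
    (forall a b, f (a - b + (b - a))%N - f (a + b)%N = H a b) ->
    (forall d, G d.+1 = G d + f d) -> G 1%N = 0 ->
    (forall d, h d = - (d%:R + 1) * f d - 2 * G d) ->
  \sum_(u <- quads n) H u.1.1 u.1.2 =
  fcoef (lam h) n + 2 * fcoef (theta (lam g)) n.
Proof.
move=> fg fH GS G1 hE; case: (posnP n) => [->|n0].
  rewrite big1_seq ?fcoef_theta ?fcoef_lam0 ?mulr0 ?addr0 // => -[[a b] [x y]].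
  by rewrite mem_quads /= => /and5P[? ? ? ?]; rewrite addn_eq0 !muln_eq0; lia.
rewrite -(eq_bigr _ (fun u _ => fH u.1.1 u.1.2)) Liouville //.
rewrite fcoef_theta !fcoef_lam // mulrA mulr_sumr -big_split /=.
apply: eq_big_seq => d; rewrite -dvdn_divisors // => dn.
have [d0 nd0 e] := dvdnE_div n0 dn.
have eG : \sum_(1 <= l < d) f l = G d.
  case: d d0 {dn nd0 e} => // d _; elim: d => [|d IHd]; first by rewrite big_geq ?G1.
  by rewrite big_nat_recr //= IHd -GS.
have f0 : f 0%N = 0 by rewrite fg mul0r.
have {e} e : n%:R = (n %/ d)%:R * d%:R :> rat by rewrite -natrM e.
rewrite {}eG hE f0 mul0rn addr0 e !fg {dn fg fH GS hE n0 e f0}.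
case: (n %/ d)%N nd0 => // m _; case: d d0 => // d _ /=.
rewrite -[_ *+ m]mulr_natr -[_ *+ d]mulr_natr !mulr2n -(natr1 m) -(natr1 d).
move: (m%:R) (d%:R) (g _) (G _) => x y z w.
ring.
Qed.

Definition lamX (j : nat) := lam (fun d => d%:R ^+ j * chi3 d).
Definition lamK (j : nat) := lam (fun d => d%:R ^+ j * k3 d).
Definition lamS (j : nat) := lam (fun d => d%:R ^+ j).

Lemma chi31 : chi3 1 = 1. Proof. by rewrite chi3E. Qed.
Lemma k30 : k3 0 = 2. Proof. by []. Qed.
Lemma k31 : k3 1 = -1. Proof. by []. Qed.

Lemma chi3S d : chi3 d.+1 = (k3 d - chi3 d) / 2.
Proof. by rewrite -addn1 chi3D k31 chi31; ring. Qed.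
Lemma k3S d : k3 d.+1 = - (k3 d + 3 * chi3 d) / 2.
Proof. by rewrite -addn1 k3D k31 chi31; ring. Qed.

Variant dist_spec (a b : nat) : nat -> Prop :=
  | DistGe of (b <= a)%N : dist_spec a b (a - b)
  | DistLe of (a <= b)%N : dist_spec a b (b - a).

Lemma distP a b : dist_spec a b (a - b + (b - a))%N.
Proof.
case: (leqP b a) => [|/ltnW] le_ab; last first.
  by rewrite (eqP le_ab) add0n; constructor.
by rewrite (eqP le_ab) addn0; constructor.
Qed.

Lemma lam_lin (k : nat) (h1 h2 : nat -> rat) :
  (forall d, k%:R * h1 d = h2 d) -> k%:R * lam h1 = lam h2.
Proof.
move=> e; apply/fpsP => -[|n]; rewrite fcoef_natl ?fcoef_lam0 ?mulr0 // !fcoef_lam //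
  mulr_sumr.
exact: eq_bigr.
Qed.

Lemma lamD f g : lam f + lam g = lam (fun d => f d + g d).
Proof.
apply/fpsP => -[|n]; rewrite fcoefD ?fcoef_lam0 ?addr0 // !fcoef_lam //.
by rewrite big_split.
Qed.
Lemma lamN f : - lam f = lam (fun d => - f d).
Proof.
by apply/fpsP => -[|n]; rewrite fcoefN ?fcoef_lam0 ?oppr0 // !fcoef_lam // sumrN.
Qed.
Lemma lamMn k f : k%:R * lam f = lam (fun d => k%:R * f d).
Proof. exact: lam_lin. Qed.

Definition lin_lam := (lamMn, lamN, lamD).

Definition conv (H : nat -> nat -> rat) : fps rat :=
  Fps (fun n => \sum_(u <- quads n) H u.1.1 u.1.2).

Lemma convE f g : lam f * lam g = conv (fun a b => f a * g b).
Proof. by apply/fpsP => n; rewrite lamM. Qed.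
Lemma convD H1 H2 : conv H1 + conv H2 = conv (fun a b => H1 a b + H2 a b).
Proof. by apply/fpsP => n; rewrite fcoefD /= big_split. Qed.
Lemma convN H : - conv H = conv (fun a b => - H a b).
Proof. by apply/fpsP => n; rewrite fcoefN /= sumrN. Qed.
Lemma convMn k H : k%:R * conv H = conv (fun a b => k%:R * H a b).
Proof. by apply/fpsP => n; rewrite fcoef_natl /= mulr_sumr. Qed.
Lemma eq_conv H1 H2 : (forall a b, H1 a b = H2 a b) -> conv H1 = conv H2.
Proof. by move=> e; apply/fpsP => n; apply: eq_bigr. Qed.

Definition lin_conv := (convE, convMn, convN, convD).

(** The multiplier [k] clears the denominators coming from [G]. In each application [f] extends to
    an even function on the integers, so f |a - b| - f (a + b) is f (a - b) - f (a + b), which the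
    addition formulas split into products of a function of a and one of b. *)
Lemma conv_Liouville (f g G : nat -> rat) (k : nat) (h : nat -> rat)
    (H : nat -> nat -> rat) :
    (forall d, f d = d%:R * g d) ->
    (forall a b, k%:R * (f (a - b + (b - a))%N - f (a + b)%N) = H a b) ->
    (forall d, G d.+1 = G d + f d) -> G 1%N = 0 ->
    (forall d, - k%:R * ((d%:R + 1) * f d + 2 * G d) = h d) ->
  conv H = lam h + (k * 2)%:R * theta (lam g).
Proof.
move=> fg fH GS G1 hE.
have -> : lam h = k%:R * lam (fun d => - (d%:R + 1) * f d - 2 * G d).
  by rewrite lamMn; congr lam; apply: funext => d; rewrite -hE; ring.
rewrite natrM -mulrA -mulrDr -(eq_conv fH) -convMn; congr (_ * _).
apply/fpsP => n; rewrite fcoefD fcoef_natl.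
exact: (Liouville_lam (H := fun a b => f (a - b + (b - a))%N - f (a + b)%N) n fg _ GS G1).
Qed.

(** * Liouville's identity for six even functions *)

Lemma theta_lamX0 :
  - (3 * (lamX 0 * lamK 1 + lamK 1 * lamX 0)) =
  lamK 1 - 2 * lamX 0 - 3 * lamX 2 + 6 * theta (lamX 0).
Proof.
rewrite /lamX /lamK !lin_conv !lin_lam.
apply: (conv_Liouville (f := fun d => d%:R * chi3 d) (k := 3)
  (G := fun d => - (d%:R * k3 d) / 6 + chi3 d / 3 - d%:R * chi3 d / 2)).
- by move=> d; ring.
- by move=> a b; case: distP => le; rewrite natrB // ?chi3B ?k3B // ?chi3D ?k3D natrD;
    field.
- by move=> d; rewrite ?chi3S ?k3S -(natr1 d); field.
- by rewrite ?chi31 ?k31; field.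
- by move=> d; field.
Qed.

Lemma theta_lamK1 :
  9 * (lamX 0 * lamX 2 + lamX 2 * lamX 0) - 6 * (lamK 1 * lamK 1) =
  2 * lamX 0 - 4 * lamK 1 - 3 * lamK 3 - 3 * lamX 2 + 6 * theta (lamK 1).
Proof.
rewrite /lamX /lamK !lin_conv !lin_lam.
apply: (conv_Liouville (f := fun d => d%:R ^+ 2 * k3 d) (k := 3)
  (G := fun d => 2 / 3 * (d%:R * k3 d) - d%:R ^+ 2 * k3 d / 2 - chi3 d / 3 + d%:R ^+
    2 * chi3 d / 2)).
- by move=> d; ring.
- by move=> a b; case: distP => le; rewrite natrB // ?chi3B ?k3B // ?chi3D ?k3D natrD;
    field.
- by move=> d; rewrite ?chi3S ?k3S -(natr1 d); field.
- by rewrite ?chi31 ?k31; field.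
- by move=> d; field.
Qed.

Lemma theta_lamX2 :
  - (9 * (lamX 2 * lamK 1 + lamK 1 * lamX 2)) -
  3 * (lamX 0 * lamK 3 + lamK 3 * lamX 0) =
  lamK 3 - 2 * lamK 1 + 2 * lamX 0 - 6 * lamX 2 - 3 * lamX 4 + 6 * theta (lamX 2).
Proof.
rewrite /lamX /lamK !lin_conv !lin_lam.
apply: (conv_Liouville (f := fun d => d%:R ^+ 3 * chi3 d) (k := 3)
  (G := fun d => d%:R * k3 d / 3 - d%:R ^+ 3 * k3 d / 6 - chi3 d / 3 + d%:R ^+ 2 *
    chi3 d -
    d%:R ^+ 3 * chi3 d / 2)).
- by move=> d; ring.
- by move=> a b; case: distP => le; rewrite natrB // ?chi3B ?k3B // ?chi3D ?k3D natrD;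
    field.
- by move=> d; rewrite ?chi3S ?k3S -(natr1 d); field.
- by rewrite ?chi31 ?k31; field.
- by move=> d; field.
Qed.

Lemma theta_lamK3 :
  9 * (lamX 0 * lamX 4 + lamX 4 * lamX 0) + 54 * (lamX 2 * lamX 2) -
  12 * (lamK 1 * lamK 3 + lamK 3 * lamK 1) =
  8 * lamK 1 - 8 * lamK 3 - 3 * lamK 5 - 6 * lamX 0 + 12 * lamX 2 - 3 * lamX 4 +
  6 * theta (lamK 3).
Proof.
rewrite /lamX /lamK !lin_conv !lin_lam.
apply: (conv_Liouville (f := fun d => d%:R ^+ 4 * k3 d) (k := 3)
  (G := fun d => - (4 / 3) * (d%:R * k3 d) + 4 / 3 * (d%:R ^+ 3 * k3 d) -
    d%:R ^+ 4 * k3 d / 2 + chi3 d - 2 * (d%:R ^+ 2 * chi3 d) + d%:R ^+ 4 * chi3 d / 2)).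
- by move=> d; ring.
- by move=> a b; case: distP => le; rewrite natrB // ?chi3B ?k3B // ?chi3D ?k3D natrD;
    field.
- by move=> d; rewrite ?chi3S ?k3S -(natr1 d); field.
- by rewrite ?chi31 ?k31; field.
- by move=> d; field.
Qed.

Lemma theta_lamS1 :
  - (12 * (lamS 1 * lamS 1)) =
  - lamS 1 - 5 * lamS 3 + 6 * theta (lamS 1).
Proof.
rewrite /lamS !lin_conv !lin_lam.
apply: (conv_Liouville (f := fun d => d%:R ^+ 2) (k := 3)
  (G := fun d => d%:R / 6 - d%:R ^+ 2 / 2 + d%:R ^+ 3 / 3)).
- by move=> d; ring.
- by move=> a b; case: distP => le; rewrite natrB // ?chi3B ?k3B // ?chi3D ?k3D natrD;
    field.
- by move=> d; rewrite ?chi3S ?k3S -(natr1 d); field.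
- by rewrite ?chi31 ?k31; field.
- by move=> d; field.
Qed.

Lemma theta_lamS3 :
  - (8 * (15 * (lamS 1 * lamS 3 + lamS 3 * lamS 1))) =
  lamS 1 - 10 * lamS 3 - 21 * lamS 5 + 30 * theta (lamS 3).
Proof.
rewrite /lamS !convE convD !convMn convN.
have -> : lam (fun d => d%:R ^+ 1) - 10 * lam (fun d => d%:R ^+ 3) -
    21 * lam (fun d => d%:R ^+ 5) =
  lam (fun d => d%:R ^+ 1 - 10 * d%:R ^+ 3 - 21 * d%:R ^+ 5).
  by rewrite 2!lamMn !lamN !lamD.
apply: (conv_Liouville (f := fun d => d%:R ^+ 4) (k := 15)
  (G := fun d => - (d%:R / 30) + d%:R ^+ 3 / 3 - d%:R ^+ 4 / 2 + d%:R ^+ 5 / 5)).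
- by move=> d; ring.
- by move=> a b; case: distP => le; rewrite natrB // ?chi3B ?k3B // ?chi3D ?k3D natrD;
    field.
- by move=> d; rewrite ?chi3S ?k3S -(natr1 d); field.
- by rewrite ?chi31 ?k31; field.
- by move=> d; field.
Qed.

Lemma k3_dvd d : k3 d + 1 = if (3 %| d)%N then 3 else 0.
Proof. by rewrite /k3 /dvdn; case: ifP. Qed.

(** Writing d = 3 e, this is the involution e -> (n/3)/e on the divisors of n/3. *)
Lemma big_divisors_inv (V : nmodType) n (F : nat -> V) : (0 < n)%N -> (3 %| n)%N ->
  \sum_(d <- divisors n | (3 %| d)%N) F d =
  \sum_(d <- divisors n | (3 %| d)%N) F (3 * (n %/ d))%N.
Proof.
move=> n0 n3; have inv3 d : (d \in [seq d <- divisors n | (3 %| d)%N]) ->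
    (3 * (n %/ d) \in [seq d <- divisors n | (3 %| d)%N])%N /\
    (3 * (n %/ (3 * (n %/ d))) = d)%N.
  rewrite !mem_filter dvdn_mulr // -!dvdn_divisors // => /andP[/dvdnP[e ->] dn].
  have [d0 nd0 en] := dvdnE_div n0 dn.
  move: (n %/ (e * 3))%N en nd0 => m en m0.
  have m3 : (0 < 3 * m)%N by lia.
  have en' : (3 * m * e = n)%N by lia.
  by rewrite (dvdn_div_eq m3 en') -{1}en' dvdn_mulr //; split=> //; lia.
rewrite -[LHS]big_filter -[RHS]big_filter.
by apply: (big_bij (psi := fun d => 3 * (n %/ d))%N);
  rewrite ?filter_uniq ?divisors_uniq.
Qed.

(** Liouville's identity for [k3], which does not vanish at 0, so that [Liouville_lam] is not
    applicable. The leftover terms (n/d) (k3 d + 1) are no derivative, but they live on multiples of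
    3, where d -> 3 n/d turns them into multiples of d (k3 d + 1). *)
Lemma lamX0_sqr : 9 * (lamX 0 * lamX 0) + 3 * lamX 0 = 2 * lamS 1 - lamK 1.
Proof.
apply/fpsP => n; case: (posnP n) => [->|n0].
  by rewrite !(fcoefD, fcoefN, fcoef_natl) fcoefM0 !fcoef_lam0; ring.
rewrite !(fcoefD, fcoefN, fcoef_natl) lamM !fcoef_lam //.
have e3 : \sum_(u <- quads n)
    (k3 (u.1.1 - u.1.2 + (u.1.2 - u.1.1))%N - k3 (u.1.1 + u.1.2)%N) =
    3 * \sum_(u <- quads n) u.1.1%:R ^+ 0 * chi3 u.1.1 * (u.1.2%:R ^+ 0 * chi3 u.1.2).
  rewrite mulr_sumr; apply: eq_bigr => -[[a b] xy] _ /=.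
  by case: distP => le; rewrite k3B // k3D; field.
rewrite -[9]/(3 * 3)%:R natrM -mulrA -e3 Liouville // k30.
have sumk d : (0 < d)%N -> \sum_(1 <= l < d) k3 l = (chi3 d - k3 d) / 2 - 1.
  case: d => // d _; elim: d => [|d IHd]; first by rewrite big_geq // chi31 k31; field.
  by rewrite big_nat_recr //= IHd (chi3S d.+1) (k3S d.+1); field.
have inv3 : \sum_(d <- divisors n) 3 * (n %/ d)%:R * (k3 d + 1) =
    \sum_(d <- divisors n) d%:R * (k3 d + 1).
  have [n3|n3] := boolP (3 %| n)%N; last first.
    apply: eq_big_seq => d; rewrite -dvdn_divisors // => dn; rewrite k3_dvd.
    by rewrite ifN ?mulr0 //; apply: contraNN n3 => /dvdn_trans; apply.
  have red (G : nat -> rat) : \sum_(d <- divisors n) G d * (k3 d + 1) =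
      \sum_(d <- divisors n | (3 %| d)%N) 3 * G d.
    rewrite [RHS]big_mkcond; apply: eq_bigr => d _.
    by rewrite k3_dvd; case: ifP; rewrite ?mulr0 // mulrC.
  rewrite !red [RHS]big_divisors_inv //.
  by apply: eq_bigr => d _; rewrite natrM.
have -> : \sum_(d <- divisors n) (k3 d *+ (n %/ d).-1 *+ 2 + 2 *+ (n %/ d).-1 -
      k3 d *+ d.-1 - (\sum_(1 <= l < d) k3 l) *+ 2) =
    \sum_(d <- divisors n) (2 / 3 * (3 * (n %/ d)%:R * (k3 d + 1)) -
      d%:R * k3 d - chi3 d).
  apply: eq_big_seq => d; rewrite -dvdn_divisors // => dn.
  have [d0 nd0 _] := dvdnE_div n0 dn; rewrite sumk //.
  case: (n %/ d)%N nd0 => // m _; case: d d0 {dn} => // d _ /=.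
  rewrite -[_ *+ m *+ 2]mulr_natr -[_ *+ m]mulr_natr -[2 *+ m]mulr_natr.
  rewrite -[_ *+ d]mulr_natr -(natr1 m) -(natr1 d) [(_ - 1) *+ 2]mulr2n.
  by field.
rewrite !big_split /= -mulr_sumr inv3 !mulrDr ?mulr_sumr -?sumrN.
rewrite ?mulr_sumr -?sumrN ?mulr_sumr -!big_split /=.
by apply: eq_bigr => d _; field.
Qed.

(** By [k3_dvd] only the divisors d = 3 e survive on the left, each contributing 3 (3 e)^j with e a
    divisor of n/3. *)
Lemma lamK_subX j : lamK j + lamS j = (3 * 3 ^ j)%:R * fps_subX 3 (lamS j).
Proof.
apply/fpsP => n; case: (posnP n) => [->|n0].
  by rewrite fcoefD fcoef_natl fcoef_subX dvdn0 div0n !fcoef_lam0 mulr0 addr0.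
rewrite fcoefD fcoef_natl fcoef_subX !(fcoef_lam _ n0) -big_split /=.
transitivity (\sum_(d <- divisors n | (3 %| d)%N) (3 * d ^ j)%:R : rat).
  rewrite [RHS]big_mkcond; apply: eq_bigr => d _.
  have := k3_dvd d; case: ifP => _ e; last by rewrite -[X in _ + X]mulr1 -mulrDr e mulr0.
  by rewrite -[X in _ + X]mulr1 -mulrDr e natrM natrX mulrC.
case: ifP => n3; last first.
  rewrite mulr0 big1_seq // => d /andP[d3]; rewrite -dvdn_divisors // => dn.
  by rewrite (dvdn_trans d3 dn) in n3.
have [n30 en] : (0 < n %/ 3 /\ n %/ 3 * 3 = n)%N by have [] := dvdnE_div n0 n3.
rewrite fcoef_lam // mulr_sumr -[LHS]big_filter.
rewrite (big_bij (s := divisors (n %/ 3)) (phi := muln 3) (psi := fun d => (d %/ 3)%N))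
  ?filter_uniq ?divisors_uniq //.
- by apply: eq_bigr => d _; rewrite expnMn mulnA natrM natrX.
- move=> d; rewrite mem_filter -!dvdn_divisors // dvdn_mulr // => dn.
  by rewrite mulKn // -[n]en mulnC dvdn_pmul2r.
- move=> d; rewrite mem_filter -!dvdn_divisors // => /andP[/dvdnP[e ->]].
  by rewrite -{1}en dvdn_pmul2r // mulnK // mulnC.
Qed.

(* These certify that [x = y] follows from given equations: the coefficients [c]
   come from eliminating by hand, and the last premise is a ring identity. *)
Lemma lincomb1 (A : pzRingType) (c x y l1 r1 : A) :
  l1 = r1 -> x - y = c * (l1 - r1) -> x = y.
Proof. by move=> ->; rewrite subrr mulr0 => /subr0_eq. Qed.

Lemma lincomb2 (A : pzRingType) (c1 c2 x y l1 r1 l2 r2 : A) :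
  l1 = r1 -> l2 = r2 -> x - y = c1 * (l1 - r1) + c2 * (l2 - r2) -> x = y.
Proof. by move=> -> ->; rewrite !subrr !mulr0 addr0 => /subr0_eq. Qed.

Lemma lincomb3 (A : pzRingType) (c1 c2 c3 x y l1 r1 l2 r2 l3 r3 : A) :
  l1 = r1 -> l2 = r2 -> l3 = r3 ->
  x - y = c1 * (l1 - r1) + c2 * (l2 - r2) + c3 * (l3 - r3) -> x = y.
Proof. by move=> -> -> ->; rewrite !subrr !mulr0 !addr0 => /subr0_eq. Qed.

Lemma lincomb4 (A : pzRingType) (c1 c2 c3 c4 x y l1 r1 l2 r2 l3 r3 l4 r4 : A) :
  l1 = r1 -> l2 = r2 -> l3 = r3 -> l4 = r4 ->
  x - y = c1 * (l1 - r1) + c2 * (l2 - r2) + c3 * (l3 - r3) + c4 * (l4 - r4) -> x = y.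
Proof. by move=> -> -> -> ->; rewrite !subrr !mulr0 !addr0 => /subr0_eq. Qed.

Lemma lincomb5 (A : pzRingType) (c1 c2 c3 c4 c5 x y l1 r1 l2 r2 l3 r3 l4 r4 l5 r5 : A) :
  l1 = r1 -> l2 = r2 -> l3 = r3 -> l4 = r4 -> l5 = r5 ->
  x - y = c1 * (l1 - r1) + c2 * (l2 - r2) + c3 * (l3 - r3) + c4 * (l4 - r4) +
    c5 * (l5 - r5) -> x = y.
Proof. by move=> -> -> -> -> ->; rewrite !subrr !mulr0 !addr0 => /subr0_eq. Qed.

(** * Cubic theta functions and Eisenstein series *)

(* [ma] and [mB] are the cubic theta functions a and b^3, [mC] is C and [mP] is
   q t'/t = a^2.  The weight 4 and 6 series [mR] and [mW] come from the twists by
   [k3]; the constants make them modular. *)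
Definition ma := 1 + 6 * lamX 0.
Definition mB := 1 - 9 * lamX 2.
Definition mC := 1 + 3 * lamX 4.
Definition mP := 1 + 8 * lamS 1 - 4 * lamK 1.
Definition mE2 := 1 - 24 * lamS 1.
Definition mE4 := 1 + 240 * lamS 3.
Definition mE6 := 1 - 504 * lamS 5.
Definition mR := 1 + 3 * lamK 3.
Definition mW := 13 - 9 * lamK 5.

Definition thetaE := (thetaD, thetaN, thetaMn, theta1, theta_nat).

Lemma mPE : mP = ma * ma.
Proof. by apply: (lincomb1 (c := -4) lamX0_sqr); rewrite /mP /ma; ring. Qed.

Lemma theta_ma : 12 * theta ma = ma * (mE2 + 3 * mP) - 4 * mB.
Proof.
apply: (lincomb1 (c := -12) theta_lamX0).
by rewrite /ma /mE2 /mP /mB !thetaE; ring.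
Qed.

Lemma theta_mT :
  12 * theta (mE2 + 3 * mP) = (mE2 + 3 * mP) ^+ 2 + 8 * ma * mB - 24 * mR.
Proof.
apply: (lincomb1 (c := 24) theta_lamK1).
by rewrite /ma /mE2 /mP /mB /mR !thetaE; ring.
Qed.

Lemma theta_mB0 : 4 * theta mB = mB * (mE2 + 3 * mP) + 2 * ma * mR - 6 * mC.
Proof.
apply: (lincomb1 (c := 6) theta_lamX2).
by rewrite /ma /mE2 /mP /mB /mR /mC !thetaE; ring.
Qed.

Lemma theta_mR :
  2 * mR * (mE2 + 3 * mP) + 3 * ma * mC + 2 * mB ^+ 2 = 6 * theta mR + mW.
Proof.
apply: (lincomb1 (c := 3) theta_lamK3).
by rewrite /ma /mE2 /mP /mB /mR /mC /mW !thetaE; ring.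
Qed.

Lemma theta_mE2 : 12 * theta mE2 = mE2 ^+ 2 - mE4.
Proof.
apply: (lincomb1 (c := 48) theta_lamS1).
by rewrite /mE2 /mE4 !thetaE; ring.
Qed.

Lemma theta_mE4 : 3 * theta mE4 = mE2 * mE4 - mE6.
Proof.
apply: (lincomb1 (c := -24) theta_lamS3).
by rewrite /mE2 /mE4 /mE6 !thetaE; ring.
Qed.

Local Notation "f ^s" := (fps_subX 3 f) (at level 2, format "f ^s").

Lemma subXE :
  (forall f g : fps rat, (f + g)^s = f^s + g^s) *
  (forall f g : fps rat, (f * g)^s = f^s * g^s) *
  (forall f : fps rat, (- f)^s = - f^s) *
  (forall k, (k%:R : fps rat)^s = k%:R) * ((1 : fps rat)^s = 1).
Proof.
split; last exact: fps_subX1.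
split; last by move=> k; exact: fps_subX_nat.
split; last by move=> f; exact: fps_subXN.
by split=> f g; rewrite ?fps_subXD ?fps_subXM.
Qed.

Lemma mE2_subX : 3 * mE2^s = 2 * mP + mE2.
Proof.
apply: (lincomb1 (c := 8) (lamK_subX 1)).
by rewrite /mE2 /mP !subXE; ring.
Qed.

Lemma mE4_subX : 80 * mR = 81 * mE4^s - mE4.
Proof.
apply: (lincomb1 (c := 240) (lamK_subX 3)).
by rewrite /mE4 /mR !subXE; ring.
Qed.

(** The factor 9 * 81 is 3^6, and comparing constant terms, 56 * 13 = 3^6 - 1, explains the 13 in
    [mW]. *)
Lemma mE6_subX : 56 * mW = 9 * (81 * mE6^s) - mE6.
Proof.
apply: (lincomb1 (c := -504) (lamK_subX 5)).
by rewrite /mE6 /mW !subXE; ring.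
Qed.

Lemma theta_mE2s : 4 * theta mE2^s = mE2^s ^+ 2 - mE4^s.
Proof.
rewrite theta_subX //; apply: (lincomb1 (c := 1) (congr1 (fps_subX 3) theta_mE2)).
by rewrite expr2 !subXE; ring.
Qed.

Lemma theta_mE4s : theta mE4^s = mE2^s * mE4^s - mE6^s.
Proof.
rewrite theta_subX //; apply: (lincomb1 (c := 1) (congr1 (fps_subX 3) theta_mE4)).
by rewrite !subXE; ring.
Qed.

(** * Elimination of the Eisenstein series of weights 4 and 6 *)

Lemma theta_mP : 6 * theta mP = mP * (mE2 + 3 * mP) - 4 * ma * mB.
Proof.
rewrite [in LHS]mPE thetaM; apply: (lincomb2 (c1 := ma) theta_ma (c2 := - (mE2 + 3 *
  mP)) mPE).
ring.
Qed.

(** Two computations of the derivative of [mE2 + 3 * mP] are compared: [theta_mT], and the separate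
    derivatives of [mE2] and [mP]. *)
Lemma mE4E_mR : mE4 = 9 * mP ^+ 2 - 32 * ma * mB + 24 * mR.
Proof.
have := theta_mT; rewrite thetaD thetaMn => eT.
apply: (lincomb3 (c1 := 1) (c2 := 6) (c3 := -1) theta_mE2 theta_mP eT).
ring.
Qed.

(** Differentiating [mE2_subX] gives a second expression for the derivative of E_2(q^3), to be
    compared with Ramanujan's equation at q^3. *)
Lemma mE4sE : 9 * mE4^s = mE4 - 8 * mP ^+ 2 + 16 * ma * mB.
Proof.
have e : 12 * (3 * theta mE2^s) =
    4 * (mP * (mE2 + 3 * mP) - 4 * ma * mB) + (mE2 ^+ 2 - mE4).
  rewrite -theta_mP -theta_mE2 -thetaMn mE2_subX thetaD thetaMn; ring.
have e2 : (3 * mE2^s) ^+ 2 = (2 * mP + mE2) ^+ 2 by rewrite mE2_subX.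
apply: (lincomb3 (c1 := 9) (c2 := -1) (c3 := 1) theta_mE2s e e2); ring.
Qed.

(** Three linear relations hold between E_4(q), E_4(q^3), [mR], [mP ^+ 2] and [ma * mB]. Eliminating
    both E_4 also removes [mP ^+ 2] and leaves 112 ([mR] - [ma * mB]) = 0. *)
Lemma mRE : mR = ma * mB.
Proof.
apply: (fps_natl_inj (k := 112)) => //.
apply: (lincomb3 (c1 := -1) (c2 := -9) (c3 := -8) mE4_subX mE4sE mE4E_mR); ring.
Qed.

Lemma mE4E : mE4 = 9 * mP ^+ 2 - 8 * mR.
Proof. by rewrite mE4E_mR mRE; ring. Qed.

Lemma mE4sE' : 9 * mE4^s = mP ^+ 2 + 8 * mR.
Proof. by rewrite mE4sE mE4E mRE; ring. Qed.

(** [mW] is a combination of E_6(q) and E_6(q^3). Ramanujan's equation for the derivative of E_4, at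
    q and at q^3, expresses both through series already known. *)
Lemma mWE : mW = 9 * mP * mR + 4 * mE2 * mR - 12 * theta mR.
Proof.
have eP : 6 * theta mP = mP * (mE2 + 3 * mP) - 4 * mR.
  by rewrite theta_mP mRE mulrA.
have e1 : 81 * mE6^s = 3 * (2 * mP + mE2) * (mP ^+ 2 + 8 * mR) -
    9 * (2 * mP * theta mP + 8 * theta mR).
  have -> : 2 * mP * theta mP + 8 * theta mR = theta (9 * mE4^s).
    by rewrite mE4sE' (thetaD (mP ^+ 2)) (thetaMn 8 mR) thetaX; ring.
  rewrite -mE2_subX -mE4sE' (thetaMn 9 mE4^s) theta_mE4s; ring.
have e2 : mE6 = mE2 * (9 * mP ^+ 2 - 8 * mR) - 3 * (18 * mP * theta mP - 8 * theta mR).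
  have -> : 18 * mP * theta mP - 8 * theta mR = theta mE4.
    rewrite mE4E (thetaD (9 * mP ^+ 2)) thetaN (thetaMn 9 (mP ^+ 2)) (thetaMn 8 mR).
    by rewrite thetaX; ring.
  by rewrite -mE4E theta_mE4; ring.
apply: (fps_natl_inj (k := 56)) => //.
apply: (lincomb4 (c1 := 1) mE6_subX (c2 := 9) e1 (c3 := -1) e2 (c4 := -18 * mP) eP).
ring.
Qed.

Lemma ma_unit : ma \is a GRing.unit.
Proof.
by rewrite fps_unitE /ma fcoefD fcoef_natl fcoef_lam0 mulr0 addr0 fcoef1.
Qed.

(** Inserting [mWE] and [mRE] into [theta_mR] cancels the terms in [mB ^+ 2]; everything that
    remains is divisible by the unit [ma]. *)
Lemma theta_mB1 : 4 * theta mB = mB * (mP + mE2) - 2 * mC.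
Proof.
apply: (fps_natl_inj (k := 3)) => //; apply: (mulrI ma_unit).
have eR : 12 * theta mR = 12 * theta ma * mB + ma * (12 * theta mB).
  by rewrite mRE thetaM; ring.
have := theta_mR; rewrite mWE => e1.
apply: (lincomb4 (c1 := 2) e1 (c2 := -1) eR (c3 := - mB) theta_ma
  (c4 := 6 * mP + 4 * mE2) mRE); ring.
Qed.

(** [theta_mB0] and [theta_mB1] give the same derivative with different multiples of [mC], so their
    difference determines [mC]. *)
Lemma mCE : mC = mP * mB.
Proof.
apply: (fps_natl_inj (k := 4)) => //.
have e : ma * mR = mP * mB by rewrite mRE mPE mulrA.
apply: (lincomb3 (c1 := 1) theta_mB0 (c2 := -1) theta_mB1 (c3 := 2) e); ring.
Qed.

Lemma theta_mB : 4 * theta mB = mB * (mE2 - mP).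
Proof. by rewrite theta_mB1 mCE; ring. Qed.

Lemma theta_mE2E : 12 * theta mE2 = mE2 ^+ 2 - 9 * mP ^+ 2 + 8 * ma * mB.
Proof. by rewrite theta_mE2 mE4E mRE; ring. Qed.

(** * The Hauptmodul *)

Definition agree (n : nat) (f g : fps rat) := forall i, (i < n)%N -> fcoef f i =
  fcoef g i.

Lemma agreeM n f f' g g' : agree n f f' -> agree n g g' -> agree n (f * g) (f' * g').
Proof.
move=> ff' gg' i i_lt; rewrite !fcoefM; apply: eq_bigr => j _.
have j_le : (j <= i)%N by rewrite -ltnS.
by rewrite ff' ?gg' // (leq_ltn_trans _ i_lt) // leq_subr.
Qed.

Lemma agreeX n k f g : agree n f g -> agree n (f ^+ k) (g ^+ k).
Proof. by move=> fg; elim: k => // k IHk; rewrite !exprS; apply: agreeM. Qed.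

Lemma agree_refl n f : agree n f f. Proof. by []. Qed.
#[local] Hint Resolve agree_refl : core.

Lemma agreeV1 n f : f \is a GRing.unit -> agree n f 1 -> agree n f^-1 1.
Proof.
move=> uf f1 i i_lt; have := agreeM f1 (@agree_refl n f^-1) i_lt.
by rewrite mul1r divrr.
Qed.

Lemma fcoef_fpsXn k n : fcoef (fpsX rat ^+ k) n = (n == k)%:R.
Proof.
elim: k n => [|k IHk] n; first by rewrite fcoef1; case: n.
rewrite exprS fcoefM; case: n => [|n]; first by rewrite big_ord_recl big_ord0 mul0r addr0.
rewrite 2!big_ord_recl /= mul0r add0r mul1r big1 ?addr0; last by move=> i _; rewrite
  mul0r.
by rewrite IHk /bump /= add1n subn1.
Qed.

Lemma fcoefXM f n : fcoef (fpsX rat * f) n.+1 = fcoef f n.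
Proof.
rewrite fcoefM 2!big_ord_recl /= mul0r add0r mul1r big1 ?addr0; last first.
  by move=> i _; rewrite mul0r.
by rewrite subn1.
Qed.

Lemma fcoefXnM k f n : fcoef (fpsX rat ^+ k * f) (k + n) = fcoef f n.
Proof.
elim: k => [|k IHk]; first by rewrite mul1r.
by rewrite exprS -mulrA addSn fcoefXM.
Qed.

Lemma theta_fpsXn n : theta (fpsX rat ^+ n) = n%:R * fpsX rat ^+ n.
Proof.
apply/fpsP => m; rewrite fcoef_natl fcoef_theta fcoef_fpsXn.
by case: eqP => [->|]; rewrite ?mulr0.
Qed.

Definition logd (f g : fps rat) := theta f = f * g.

Lemma logdM f f' g g' : logd f g -> logd f' g' -> logd (f * f') (g + g').
Proof. by rewrite /logd thetaM => -> ->; ring. Qed.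
Lemma logdX f g k : logd f g -> logd (f ^+ k) (k%:R * g).
Proof.
move=> fg; elim: k => [|k IHk]; first by rewrite /logd theta1 mul0r mulr0.
by rewrite exprS mulrS mulrDl mul1r; apply: logdM.
Qed.
Lemma logdV f g : f \is a GRing.unit -> logd f g -> logd f^-1 (- g).
Proof.
move=> uf fg; apply: (mulrI uf); rewrite mulrA divrr // mul1r.
have := thetaM f f^-1; rewrite divrr // theta1 fg => /esym/eqP.
by rewrite addr_eq0 mulrAC divrr // mul1r => /eqP ->; rewrite opprK.
Qed.
Lemma logd_prod (G g : nat -> fps rat) m n :
  (forall i, (m <= i < n)%N -> logd (G i) (g i)) ->
  logd (\prod_(m <= i < n) G i) (\sum_(m <= i < n) g i).
Proof.
move=> Gg; rewrite big_seq [X in logd _ X]big_seq.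
apply: (big_rec2 logd) => [|i f s /[!mem_index_iota] i_in fs]; last first.
  by rewrite addrC mulrC; apply: logdM => //; apply: Gg.
by rewrite /logd theta1 mulr0.
Qed.

(** The geometric series q^n / (1 - q^n). *)
Definition mults (n : nat) : fps rat :=
  Fps (fun m => if (0 < m)%N && (n %| m)%N then 1 else 0).

Lemma multsE n : (0 < n)%N -> (1 - fpsX rat ^+ n) * mults n = fpsX rat ^+ n.
Proof.
move=> n0; apply/fpsP => m; rewrite mulrBl mul1r fcoefB.
have [m_lt|] := ltnP m n.
  rewrite fcoef_fpsXn ltn_eqF // mulrC (@fcoefM_eq0 _ _ _ m); last first.
    by move=> i i_lt; rewrite fcoef_fpsXn ltn_eqF // (ltn_trans i_lt).
  rewrite fcoef_fpsXn ltn_eqF // mulr0 subr0 /=.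
  by case: m m_lt => // m m_lt; rewrite gtnNdvd.
move=> /subnKC <-; rewrite fcoefXnM fcoef_fpsXn /= dvdn_addr // addn_gt0 n0 /=.
by case: (m - n)%N => [|k]; rewrite ?addn0 ?eqxx ?dvdn0 ?subr0 //=
  -[X in _ == X]addn0 eqn_add2l; case: ifP; rewrite ?subrr.
Qed.

Lemma logd_1subX n : (0 < n)%N -> logd (1 - fpsX rat ^+ n) (- (n%:R * mults n)).
Proof.
move=> n0; rewrite /logd thetaD theta1 thetaN theta_fpsXn add0r mulrN mulrCA.
by rewrite multsE.
Qed.

Lemma agree_1subX n : agree n (1 - fpsX rat ^+ n) 1.
Proof. by move=> i i_lt; rewrite fcoefB fcoef_fpsXn ltn_eqF // subr0. Qed.

Lemma unit_1subX n : (0 < n)%N -> 1 - fpsX rat ^+ n \is a GRing.unit.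
Proof. by move=> n0; rewrite fps_unitE (agree_1subX n0). Qed.

Definition tau_factor (n : nat) : fps rat :=
  (1 - fpsX rat ^+ (3 * n)) ^+ 12 * (1 - fpsX rat ^+ n) ^- 12.
Definition tau : fps rat := fps_prod tau_factor.

Lemma agree_tau_factor n : (0 < n)%N -> agree n (tau_factor n) 1.
Proof.
move=> n0; rewrite -[X in agree n _ X]mulr1.
have agree12 k : (n <= k)%N -> agree n ((1 - fpsX rat ^+ k) ^+ 12) 1.
  move=> n_le; rewrite -[X in agree n _ X](expr1n _ 12); apply: agreeX => i i_lt.
  by apply: agree_1subX; apply: leq_trans n_le.
apply: agreeM; first by apply: agree12; rewrite leq_pmull.
by apply: agreeV1; rewrite ?unitrX ?unit_1subX //; apply: agree12.
Qed.

Lemma agree_tau N : agree N.+1 (\prod_(1 <= n < N.+1) tau_factor n) tau.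
Proof.
move=> i; rewrite ltnS; apply: fps_prod_stable => n j n0 j_lt.
exact: agree_tau_factor.
Qed.

Lemma logd_tau_factor n : (0 < n)%N ->
  logd (tau_factor n) (12 * (n%:R * mults n) - 36 * (n%:R * mults (3 * n))).
Proof.
move=> n0; have n3 : (0 < 3 * n)%N by rewrite muln_gt0.
have -> : 12 * (n%:R * mults n) - 36 * (n%:R * mults (3 * n)) =
    12 * - ((3 * n)%:R * mults (3 * n)) - 12 * - (n%:R * mults n).
  by rewrite natrM; ring.
apply: logdM; first exact/logdX/logd_1subX.
apply: logdV; first by rewrite unitrX ?unit_1subX.
exact/logdX/logd_1subX.
Qed.

Lemma sum_mults N m k : (0 < m <= N)%N -> (0 < k)%N ->
  fcoef (\sum_(1 <= n < N.+1) n%:R * mults (k * n)) m =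
  fcoef (fps_subX k (lamS 1)) m.
Proof.
move=> /andP[m0 mN] k0; rewrite fcoef_sum fcoef_subX.
transitivity (\sum_(1 <= n < N.+1 | (k * n %| m)%N) n%:R : rat).
  rewrite [RHS]big_mkcond; apply: eq_bigr => n _; rewrite fcoef_natl /= m0 /=.
  by case: ifP; rewrite ?mulr1 ?mulr0.
case: ifP => km; last first.
  by rewrite big1_seq // => n /andP[knm _]; rewrite (dvdn_trans _ knm) ?dvdn_mulr in km.
have [_ mk0 e] := dvdnE_div m0 km; rewrite fcoef_lam // -big_filter.
apply: perm_big; apply: uniq_perm; rewrite ?filter_uniq ?iota_uniq ?divisors_uniq //.
move=> n; rewrite mem_filter mem_index_iota -dvdn_divisors //.
rewrite -[X in (_ %| X)%N]e mulnC dvdn_pmul2r //.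
case: (boolP (n %| m %/ k)%N) => //= nk.
by rewrite (dvdn_gt0 mk0 nk) ltnS (leq_trans (dvdn_leq mk0 nk)) // (leq_trans _ mN)
  // leq_div.
Qed.

Lemma sum_mults0 N k : fcoef (\sum_(1 <= n < N.+1) n%:R * mults (k * n)) 0%N = 0.
Proof. by rewrite fcoef_sum big1 // => n _; rewrite fcoef_natl mulr0. Qed.

Lemma mP_subX : mP - 1 = 12 * fps_subX 1 (lamS 1) - 36 * fps_subX 3 (lamS 1).
Proof.
have -> : fps_subX 1 (lamS 1) = lamS 1.
  by apply/fpsP => n; rewrite fcoef_subX dvd1n divn1.
by apply: (lincomb1 (c := -4) (lamK_subX 1)); rewrite /mP; ring.
Qed.

(** Up to order N only a finite partial product matters. Its logarithmic derivative is a finite sum,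
    which agrees to that order with 12 S(q) - 36 S(q^3), S being [lamS 1]; this is [mP - 1]. *)
Lemma theta_tau : theta tau = tau * (mP - 1).
Proof.
apply/fpsP => N; rewrite fcoef_theta.
have t_tau := @agree_tau N; set T := \prod_(_ <= _ < _) _ in t_tau.
set g := fun n => 12 * (n%:R * mults (1 * n)) - 36 * (n%:R * mults (3 * n)).
have : logd T (\sum_(1 <= n < N.+1) g n).
  apply: logd_prod => n /andP[n0 _]; rewrite /g mul1n; exact: logd_tau_factor.
rewrite /logd => /fpsP/(_ N); rewrite fcoef_theta t_tau // => ->.
apply: (@agreeM N.+1) => // i i_lt; rewrite mP_subX.
rewrite /g sumrB -!mulr_sumr !(fcoefB, fcoef_natl).
case: i i_lt => [|i] i_lt; last by rewrite !sum_mults.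
by rewrite !sum_mults0 !fcoef_subX !dvdn0 !div0n fcoef_lam0.
Qed.

Lemma tqE : tq = fpsX rat * tau. Proof. by []. Qed.

Lemma theta_tq : theta tq = tq * mP.
Proof.
have eX : theta (fpsX rat) = fpsX rat by have := theta_fpsXn 1; rewrite mul1r.
by rewrite tqE thetaM eX theta_tau; ring.
Qed.

Lemma fcoef_tau0 : fcoef tau 0%N = 1.
Proof. by rewrite -(@agree_tau 0) // big_geq. Qed.

Lemma fcoef_tq0 : fcoef tq 0%N = 0.
Proof. by rewrite tqE fcoefM0 mul0r. Qed.

Lemma fcoef_tq1 : fcoef tq 1%N = 1.
Proof. by rewrite tqE fcoefXM fcoef_tau0. Qed.

(* The lowest nonzero coefficient of [D], of index [n], would give [k n = g_0]. *)
Lemma theta_uniq (k n0 : nat) (D g : fps rat) :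
  k%:R * theta D = D * g -> (forall i, (i < n0)%N -> fcoef D i = 0) ->
  (forall n, (n0 <= n)%N -> k%:R * n%:R != fcoef g 0%N) -> D = 0.
Proof.
move=> e D0 g0; apply/fpsP => n; rewrite fcoef0.
elim/ltn_ind: n => n IHn; have [/D0 //|n_ge] := ltnP n n0.
move/fpsP: e => /(_ n); rewrite fcoef_natl fcoef_theta.
rewrite [D * g]mulrC fcoefM_eq0 // mulrA => /eqP.
by rewrite -subr_eq0 -mulrBl mulf_eq0 subr_eq0 (negbTE (g0 _ n_ge)) => /eqP.
Qed.

Lemma fcoef_lam1 f : fcoef (lam f) 1%N = f 1%N.
Proof. by rewrite fcoef_lam // big_seq1. Qed.

Lemma fcoefM1 (f g : fps rat) :
  fcoef (f * g) 1%N = fcoef f 0%N * fcoef g 1%N + fcoef f 1%N * fcoef g 0%N.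
Proof. by rewrite fcoefM 2!big_ord_recl big_ord0 addr0. Qed.

(** As [mP] = a^2, this is the Borweins' a^3 = b^3 + c^3 with c^3 = 27 t b^3. The difference of the
    two sides satisfies a first-order equation. *)
Lemma mPB_tq : ma * mP = mB * (1 + 27 * tq).
Proof.
apply/subr0_eq; set D := _ - _.
have B27 : mB * (1 + 27 * tq) = ma * mP - D by rewrite /D; ring.
apply: (@theta_uniq 4 2 D (mE2 + 3 * mP)) => [||n n2].
- apply: (@fps_natl_inj 3) => //.
  have eP := theta_mP; have eB := theta_mB; have ea := theta_ma; have ePa := mPE.
  have eD : theta D = theta ma * mP + ma * theta mP -
      (theta mB * (1 + 27 * tq) + mB * (27 * (tq * mP))).
    rewrite /D (thetaD (ma * mP)) thetaN !(thetaM ma, thetaM mB).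
    by rewrite (thetaD 1 (27 * tq)) theta1 (thetaMn 27 tq) theta_tq add0r.
  rewrite eD.
  apply: (lincomb4 (c1 := mP) ea (c2 := 2 * ma) eP (c3 := - 3 * (1 + 27 * tq)) eB
    (c4 := 8 * mB) ePa).
  by rewrite /D; ring.
(* The constant term of [mE2 + 3 * mP] is 4 = 4 * 1, so the equation leaves the coefficient of q
   free. Hence two initial coefficients have to be compared. *)
- have [a0 a1] : fcoef ma 0%N = 1 /\ fcoef ma 1%N = 6.
    by rewrite !fcoefD !fcoef1 !fcoef_natl fcoef_lam0 fcoef_lam1 chi31.
  have [B0 B1] : fcoef mB 0%N = 1 /\ fcoef mB 1%N = - 9.
    by rewrite !fcoefB !fcoef1 !fcoef_natl fcoef_lam0 fcoef_lam1 chi31.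
  have [P0 P1] : fcoef mP 0%N = 1 /\ fcoef mP 1%N = 12.
    by rewrite !fcoefB !fcoefD !fcoef1 !fcoef_natl !fcoef_lam0 !fcoef_lam1 k31.
  have [t0 t1] : fcoef (1 + 27 * tq) 0%N = 1 /\ fcoef (1 + 27 * tq) 1%N = 27.
    by rewrite !fcoefD !fcoef1 !fcoef_natl fcoef_tq0 fcoef_tq1.
  move=> [|[|//]] _; rewrite /D fcoefB.
    by rewrite (fcoefM0 ma) (fcoefM0 mB) a0 B0 P0 t0.
  by rewrite (fcoefM1 ma) (fcoefM1 mB) a0 B0 P0 t0 a1 B1 P1 t1.
- rewrite /mE2 /mP !(fcoefD, fcoefN, fcoef_natl, fcoef_lam0, fcoef1) /=.
  have -> : 1 - 24 * 0 + 3 * (1 + 8 * 0 - 4 * 0) = 4 * 1%:R :> rat by ring.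
  by rewrite (inj_eq (mulfI _)) // eqr_nat gtn_eqF.
Qed.

(** * Composition and the hypergeometric series *)

Lemma fcoefCM (c : rat) f n : fcoef (fpsC c * f) n = c * fcoef f n.
Proof.
by rewrite fcoefM big_ord_recl /= subn0 big1 ?addr0 // => i _; rewrite mul0r.
Qed.

Fact fpsC_zmod_morphism : zmod_morphism (@fpsC rat).
Proof. by move=> x y; apply/fpsP => n; rewrite fcoefB /=; case: ifP; rewrite ?subr0. Qed.
Fact fpsC_monoid_morphism : monoid_morphism (@fpsC rat).
Proof.
split=> // x y; apply/fpsP => n; rewrite fcoefCM /=.
by case: ifP; rewrite ?mulr0.
Qed.
HB.instance Definition _ :=
  GRing.isZmodMorphism.Build rat (fps rat) (@fpsC rat) fpsC_zmod_morphism.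
HB.instance Definition _ :=
  GRing.isMonoidMorphism.Build rat (fps rat) (@fpsC rat) fpsC_monoid_morphism.

Section Comp.
Variable s : fps rat.
Hypothesis s0 : fcoef s 0%N = 0.

(* [f (s (q))]: as [s] has no constant term, [s ^+ k] does not contribute to the
   coefficients of index less than [k]. *)
Definition fps_comp (f : fps rat) : fps rat :=
  Fps (fun n => \sum_(k < n.+1) fcoef f k * fcoef (s ^+ k) n).

Lemma fcoef_comp f n :
  fcoef (fps_comp f) n = \sum_(k < n.+1) fcoef f k * fcoef (s ^+ k) n.
Proof. by []. Qed.

Lemma fcoef_horner_comp (p : {poly rat}) n :
  fcoef (map_poly (@fpsC rat) p).[s] n = \sum_(k < n.+1) p`_k * fcoef (s ^+ k) n.
Proof.
pose N := maxn (size p) n.+1.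
rewrite (@horner_coef_wide _ N); last first.
  by rewrite (leq_trans (size_poly _ _)) // leq_maxl.
rewrite fcoef_sum (eq_bigr (fun k : 'I_N => p`_k * fcoef (s ^+ k) n)); last first.
  by move=> k _; rewrite coef_map fcoefCM.
rewrite -(big_mkord xpredT (fun k => p`_k * fcoef (s ^+ k) n)).
rewrite (@big_cat_nat _ _ _ n.+1) ?leq_maxr //= big_mkord [X in _ + X]big_nat_cond.
rewrite [X in _ + X]big1 ?addr0 // => k /andP[/andP[k_gt _] _].
by rewrite fcoefX_small // mulr0.
Qed.

Lemma comp_trunc n f : agree n.+1 (fps_comp f) (map_poly (@fpsC rat) (fps_trunc n f)).[s].
Proof.
move=> i i_lt; rewrite fcoef_horner_comp fcoef_comp; apply: eq_bigr => k _.
by rewrite coef_fps_trunc // -ltnS (leq_trans (ltn_ord k)).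
Qed.

(** Up to order n, composition is evaluation of a truncated polynomial at [s], and evaluation is
    multiplicative. *)
Lemma compM f g : fps_comp (f * g) = fps_comp f * fps_comp g.
Proof.
apply/fpsP => n; rewrite (agreeM (@comp_trunc n f) (@comp_trunc n g)) //.
rewrite -hornerM -rmorphM fcoef_horner_comp; apply: eq_bigr => k _; congr (_ * _).
by apply: fcoef_mul_trunc; rewrite -ltnS.
Qed.

Lemma compD f g : fps_comp (f + g) = fps_comp f + fps_comp g.
Proof.
apply/fpsP => n; rewrite fcoefD !fcoef_comp -big_split; apply: eq_bigr => k _.
by rewrite fcoefD mulrDl.
Qed.

Lemma compMn k f : fps_comp (k%:R * f) = k%:R * fps_comp f.
Proof.
apply/fpsP => n; rewrite fcoef_natl !fcoef_comp mulr_sumr; apply: eq_bigr => i _.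
by rewrite fcoef_natl mulrA.
Qed.

Lemma compN f : fps_comp (- f) = - fps_comp f.
Proof.
apply/fpsP => n; rewrite fcoefN !fcoef_comp -sumrN; apply: eq_bigr => i _.
by rewrite fcoefN mulNr.
Qed.

Lemma comp1 : fps_comp 1 = 1.
Proof.
apply/fpsP => n; rewrite fcoef_comp big_ord_recl mul1r expr0 big1 ?addr0 // => i _.
by rewrite fcoef1 mul0r.
Qed.

Lemma compXn f k : fps_comp (f ^+ k) = fps_comp f ^+ k.
Proof. by elim: k => [|k IHk]; rewrite ?comp1 // !exprS compM IHk. Qed.

Lemma comp_fpsX : fps_comp (fpsX rat) = s.
Proof.
apply/fpsP => -[|n]; rewrite fcoef_comp.
  by rewrite big_ord_recl big_ord0 mul0r addr0 s0.
rewrite 2!big_ord_recl /= mul0r mul1r add0r big1 ?addr0 // => i _.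
by rewrite mul0r.
Qed.

Lemma fcoef_comp0 f : fcoef (fps_comp f) 0%N = fcoef f 0%N.
Proof. by rewrite fcoef_comp big_ord_recl big_ord0 expr0 fcoef1 mulr1 addr0. Qed.

(** The chain rule. As [s] is not invertible, its logarithmic derivative is supplied as [u]. *)
Lemma theta_comp (u f : fps rat) : theta s = s * u ->
  theta (fps_comp f) = fps_comp (theta f) * u.
Proof.
move=> su; have tsk k : theta (s ^+ k) = k%:R * (s ^+ k * u).
  case: k => [|k]; first by rewrite theta1 mul0r.
  by rewrite thetaX su exprS; ring.
apply/fpsP => n; rewrite fcoef_theta.
have eN (g : fps rat) i : (i <= n)%N ->
    fcoef (fps_comp g) i = \sum_(k < n.+1) fcoef g k * fcoef (s ^+ k) i.
  move=> i_le /=; rewrite -(big_mkord xpredT (fun k => fcoef g k * fcoef (s ^+ k) i)).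
  rewrite -[RHS](big_mkord xpredT (fun k => fcoef g k * fcoef (s ^+ k) i)).
  have i_le' : (i.+1 <= n.+1)%N by [].
  rewrite [RHS](big_cat_nat _ i_le') //= [X in _ = _ + X]big_nat_cond.
  rewrite [X in _ = _ + X]big1 ?addr0 // => k /andP[/andP[k_gt _] _].
  by rewrite fcoefX_small // mulr0.
rewrite eN // mulr_sumr fcoefM.
transitivity (\sum_(i < n.+1) \sum_(k < n.+1)
    fcoef (theta f) k * fcoef (s ^+ k) i * fcoef u (n - i)%N); last first.
  by apply: eq_bigr => i _; rewrite (eN _ _ (ltn_ord i)) mulr_suml.
rewrite exchange_big; apply: eq_bigr => k _ /=.
rewrite mulrCA -fcoef_theta tsk fcoef_natl fcoefM fcoef_theta !mulr_sumr.
by apply: eq_bigr => i _; move: (nat_of_ord k) (n - i)%N => j m; ring.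
Qed.

End Comp.

Definition rescale (c : rat) (f : fps rat) : fps rat :=
  Fps (fun n => c ^+ n * fcoef f n).

Lemma rescaleM c f g : rescale c (f * g) = rescale c f * rescale c g.
Proof.
apply/fpsP => n; rewrite [RHS]fcoefM /= mulr_sumr; apply: eq_bigr => i _.
have i_le : (i <= n)%N by rewrite -ltnS.
by rewrite -{1}(subnKC i_le) exprD mulrACA.
Qed.

(** Rescaling by -27 moves the singular point 1 of the hypergeometric equation to the zero of 1 + 27
    t, a factor that [mPB_tq] expresses through a and b. *)
Definition hypA : fps rat := rescale (- 27) (hyp2F1 (1 / 3) (1 / 3) 1).

Lemma hypA3 n : fcoef (hypA ^+ 3) n = (-1) ^+ n * A n.
Proof.
have -> : hypA ^+ 3 = rescale (- 27) (hyp2F1 (1 / 3) (1 / 3) 1 ^+ 3).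
  by rewrite !exprS expr0 !mulr1 !rescaleM.
by rewrite /A mulrA -exprMn mulN1r.
Qed.

Lemma rising1_neq0 n : rising (1 : rat) n != 0.
Proof.
by apply/prodf_neq0 => i _; rewrite addrC natr1 pnatr_eq0.
Qed.

(** The polynomial on the right is 27 (n + 1/3)^2, from the two parameters 1/3. *)
Lemma hypA_rec n :
  n.+1%:R ^+ 2 * fcoef hypA n.+1 = - (27 * n%:R ^+ 2 + 18 * n%:R + 3) * fcoef hypA n.
Proof.
rewrite /= /rising !big_ord_recr /= factS natrM [_ ^+ n.+1]exprS.
have r0 := rising1_neq0 n; rewrite /rising in r0 *.
have f0 : n`!%:R != 0 :> rat by rewrite pnatr_eq0 -lt0n fact_gt0.
have n0 : n%:R + 1 != 0 :> rat by rewrite natr1 pnatr_eq0.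
rewrite -(natr1 n) [1 + n%:R]addrC.
move: (\prod_(i < n) (1 + i%:R)) (\prod_(i < n) (1 / 3 + i%:R)) r0 => x y x0.
move: (n`!%:R) f0 (n%:R) n0 ((-27) ^+ n) => z z0 w w0 v.
by field; rewrite x0 z0 w0.
Qed.

Lemma hypA_ode : theta (theta hypA) =
  - (fpsX rat * (27 * theta (theta hypA) + 18 * theta hypA + 3 * hypA)).
Proof.
apply/fpsP => -[|n]; first by rewrite fcoef_theta mul0r fcoefN fcoefM0 mul0r oppr0.
rewrite fcoefN fcoefXM !(fcoefD, fcoef_natl, fcoef_theta) mulrA -expr2 hypA_rec.
by move: (fcoef hypA n) (n%:R) => x y; ring.
Qed.

Definition hypt := fps_comp tq hypA.

Lemma fcoef_hypA0 : fcoef hypA 0%N = 1.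
Proof. by rewrite /= /rising !big_ord0. Qed.

Lemma fcoef_mE2BmP : fcoef (mE2 - mP) 0%N = 0.
Proof.
by rewrite !(fcoefB, fcoefD) !fcoef1 !fcoef_natl !fcoef_lam0.
Qed.

(* [E] measures the failure of the claim.  The hypergeometric operator, pulled back
   along [t], has [theta - (mE2 - mP) / 12] as a right factor, so that [E] satisfies
   a first-order equation. *)
Lemma theta_hypt : 12 * theta hypt = hypt * (mE2 - mP).
Proof.
have t0 := fcoef_tq0; have M0 := fcoef_mE2BmP.
set h1 := fps_comp tq (theta hypA); set h2 := fps_comp tq (theta (theta hypA)).
have eh : theta hypt = h1 * mP := theta_comp t0 hypA theta_tq.
have eh1 : theta h1 = h2 * mP := theta_comp t0 (theta hypA) theta_tq.
have eh2 : h2 = - (tq * (27 * h2 + 18 * h1 + 3 * hypt)).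
  rewrite {1}/h2 hypA_ode compN (compM t0) (comp_fpsX t0) !compD !compMn.
  by [].
apply/subr0_eq; set E := _ - _.
have eE : E = 12 * (h1 * mP) - hypt * (mE2 - mP) by rewrite /E eh.
have etE : theta E = 12 * (h2 * mP * mP + h1 * theta mP) -
    (h1 * mP * (mE2 - mP) + hypt * (theta mE2 - theta mP)).
  rewrite eE (thetaD (12 * (h1 * mP))) thetaN (thetaMn 12 (h1 * mP)) !(thetaM h1,
    thetaM hypt).
  by rewrite eh1 eh (thetaD mE2) thetaN.
apply: (@theta_uniq 12 1 E (mE2 - mP)) => [||n n1].
(* The equation for [h2] has leading coefficient 1 + 27 t. After multiplication by [ma * mP ^+ 2],
   the factor [ma * mP] can be replaced by [mB * (1 + 27 * tq)]. *)
- have u1 : ma * mP ^+ 2 \is a GRing.unit.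
    by rewrite unitrM ma_unit unitrX // mPE unitrM ma_unit.
  apply: (mulrI u1); rewrite etE eE.
  pose tP := mP * (mE2 + 3 * mP) - 4 * ma * mB.
  (* [tP] is 6 times the derivative of [mP]. [Z] is 12 times the derivative of [E] without its term
     in [h2], with the derivatives of [mP] and [mE2] substituted. *)
  pose Z := 24 * h1 * tP - 12 * h1 * mP * (mE2 - mP) -
    hypt * (mE2 ^+ 2 - 9 * mP ^+ 2 + 8 * ma * mB - 2 * tP).
  apply: (lincomb5 mPB_tq eh2 theta_mP theta_mE2E mPE
    (c1 := 12 * mP * (12 * (h2 * mP * mP + h1 * theta mP) -
      (h1 * mP * (mE2 - mP) + hypt * (theta mE2 - theta mP))) +
      (96 * h1 + 16 * hypt) * mP ^+ 3 - mP * Z)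
    (c2 := 144 * mP ^+ 3 * mB)
    (c3 := mP * mB * (1 + 27 * tq) * (24 * h1 + 2 * hypt))
    (c4 := - mP * mB * (1 + 27 * tq) * hypt)
    (c5 := (96 * h1 + 16 * hypt) * mB * mP ^+ 2)).
  rewrite /Z /tP; ring.
- move=> [|//] _; rewrite eE fcoefB fcoef_natl (fcoefM0 h1) (fcoefM0 hypt) M0.
  by rewrite fcoef_comp0 fcoef_theta !mul0r !mulr0 subrr.
- by rewrite M0 -natrM pnatr_eq0; case: n n1.
Qed.

(** By [theta_mB] and [theta_hypt] both sides have logarithmic derivative ([mE2 - mP])/4, and both
    have constant term 1. *)
Lemma mB_hypt : mB = hypt ^+ 3.
Proof.
apply/subr0_eq; apply: (@theta_uniq 4 1 _ (mE2 - mP)) => [|[|//] _|n n1].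
- rewrite (thetaD mB) thetaN thetaX mulrBr theta_mB.
  by apply: (lincomb1 (c := - hypt ^+ 2) theta_hypt); ring.
- rewrite fcoefB !exprS expr0 mulr1 !(fcoefM0 hypt) fcoef_comp0 fcoef_hypA0.
  by rewrite fcoefB fcoef1 fcoef_natl fcoef_lam0 mulr0 subr0 !mulr1 subrr.
- by rewrite fcoef_mE2BmP -natrM pnatr_eq0; case: n n1.
Qed.

Lemma mB_comp : mB = fps_comp tq (Fps (fun n => (-1) ^+ n * A n)).
Proof.
rewrite mB_hypt -compXn ?fcoef_tq0 //; congr fps_comp.
by apply/fpsP => n; rewrite hypA3.
Qed.

(** * Residues *)

Lemma Cq_mC : Cq = mC.
Proof.
apply/fpsP => n; rewrite /mC fcoefD fcoef_natl fcoef1 /=.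
case: n => [|n]; first by rewrite fcoef_lam0 mulr0 addr0.
rewrite add0r /c fcoef_lam //; congr (_ * _).
by apply: eq_bigr => d _; rewrite mulrC.
Qed.

Lemma tau_unit : tau \is a GRing.unit.
Proof. by rewrite fps_unitE fcoef_tau0 oner_eq0. Qed.

(** For j > 0, t^-j [mP] is -1/j times the Euler derivative of t^-j, hence has no term in q^0. *)
Lemma residue_tau j : fcoef (tau^-1 ^+ j * mP) j = (j == 0%N)%:R.
Proof.
case: j => [|j].
  by rewrite expr0 mul1r fcoefB fcoefD fcoef1 !fcoef_natl !fcoef_lam0.
have /(logdX j.+1) : logd tau^-1 (- (mP - 1)) := logdV tau_unit theta_tau.
rewrite /logd => /fpsP/(_ j.+1); rewrite fcoef_theta.
have -> : tau^-1 ^+ j.+1 * (j.+1%:R * - (mP - 1)) =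
  j.+1%:R * (tau^-1 ^+ j.+1 - tau^-1 ^+ j.+1 * mP) by ring.
rewrite fcoef_natl => /mulfI; rewrite pnatr_eq0 => /(_ isT).
rewrite fcoefB => /eqP; rewrite -subr_eq0 opprB addrC subrK => /eqP ->.
by [].
Qed.

Lemma residue_tq k j :
  fcoef (tq ^+ k * (mP * tau^-1 ^+ (k + j))) (k + j) = (j == 0%N)%:R.
Proof.
rewrite -residue_tau tqE exprMn exprD.
have -> : fpsX rat ^+ k * tau ^+ k * (mP * (tau^-1 ^+ k * tau^-1 ^+ j)) =
   fpsX rat ^+ k * (tau^-1 ^+ j * mP) * (tau ^+ k * tau^-1 ^+ k) by ring.
by rewrite -exprMn divrr ?tau_unit // expr1n mulr1 fcoefXnM.
Qed.

(** Since C dq/q = b^3 dt/t, the residue of C t^-n dq/q is the coefficient of t^n in b^3, which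
    [mB_comp] provides. *)
Lemma fcoef_Cq_tau n : fcoef (Cq * tau^-1 ^+ n) n = (-1) ^+ n * A n.
Proof.
set a := Fps (fun n => (-1) ^+ n * A n); set g := tau^-1 ^+ n.
have eB : agree n.+1 mB (\sum_(k < n.+1) fpsC (fcoef a k) * tq ^+ k).
  move=> i i_lt; rewrite mB_comp fcoef_sum fcoef_comp.
  rewrite -(big_mkord xpredT (fun k => fcoef a k * fcoef (tq ^+ k) i)).
  rewrite (eq_bigr (fun k : 'I_n.+1 => fcoef a k * fcoef (tq ^+ k) i)); last first.
    by move=> k _; rewrite fcoefCM.
  rewrite -[RHS](big_mkord xpredT (fun k => fcoef a k * fcoef (tq ^+ k) i)).
  rewrite [RHS](big_cat_nat _ i_lt) //= [X in _ = _ + X]big_nat_cond.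
  rewrite [X in _ = _ + X]big1 ?addr0 // => k /andP[/andP[k_gt _] _].
  by rewrite fcoefX_small ?mulr0 // fcoef_tq0.
rewrite Cq_mC mCE mulrAC mulrC.
rewrite (agreeM eB (@agree_refl n.+1 (mP * g))) // mulr_suml fcoef_sum.
rewrite (eq_bigr (fun k : 'I_n.+1 => fcoef a k * (n - k == 0)%N%:R)); last first.
  move=> k _; rewrite -mulrA fcoefCM; congr (_ * _).
  by have := residue_tq k (n - k); rewrite subnKC // -ltnS.
rewrite big_ord_recr /= subnn mulr1 big1 ?add0r // => k _.
by rewrite subn_eq0 leqNgt ltn_ord mulr0.
Qed.

(** * Congruences *)

Section Zloc.
Variable p : nat.
Hypothesis p_prime : prime p.

(** Any denominator prime to p will do, reduced or not, which makes closure under sums and products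
    immediate. *)
Lemma ZlocP (x : rat) :
  reflect (exists d : nat, ~~ (p %| d)%N /\ exists z : int, d%:R * x = z%:~R) (Zloc p x).
Proof.
apply: (iffP idP) => [xl|[d [pd [z e]]]].
  exists `|denq x|%N; split=> //; exists (numq x).
  rewrite -{2}(divq_num_den x) -[_%:R]/((`|denq x|%N : int)%:~R) absz_denq mulrCA.
  by rewrite divff ?mulr1 // intr_eq0 denq_eq0.
apply: contraNN pd => pden; apply: dvdn_trans pden _.
have : (numq x * d = z * denq x)%R.
  have ex : x * (denq x)%:~R = (numq x)%:~R.
    by rewrite -{1}(divq_num_den x) divfK // intr_eq0 denq_eq0.
  by apply: (@intr_inj rat); rewrite !intrM -e -mulrA ex mulrC.
move=> e2; have : (denq x %| numq x * d)%Z by rewrite e2 dvdz_mull.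
rewrite Gauss_dvdzr; last by rewrite coprimezE coprime_sym coprime_num_den.
by rewrite dvdzE absz_nat.
Qed.

Lemma Zloc_int (z : int) : Zloc p z%:~R.
Proof.
apply/ZlocP; exists 1%N; rewrite dvdn1 (gtn_eqF (prime_gt1 p_prime)).
by split=> //; exists z; rewrite mul1r.
Qed.

Lemma Zloc_nat (n : nat) : Zloc p n%:R.
Proof. exact: (Zloc_int n). Qed.

Lemma ZlocN x : Zloc p x -> Zloc p (- x).
Proof. by rewrite /Zloc denqN. Qed.

Lemma ZlocD x y : Zloc p x -> Zloc p y -> Zloc p (x + y).
Proof.
move=> /ZlocP[d [pd [z ez]]] /ZlocP[d' [pd' [z' ez']]]; apply/ZlocP.
exists (d * d')%N; split; first by rewrite Euclid_dvdM // negb_or pd.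
exists (z * d' + z' * d)%R; rewrite natrM intrD !intrM -ez -ez' -!pmulrn; ring.
Qed.

Lemma ZlocM x y : Zloc p x -> Zloc p y -> Zloc p (x * y).
Proof.
move=> /ZlocP[d [pd [z ez]]] /ZlocP[d' [pd' [z' ez']]]; apply/ZlocP.
exists (d * d')%N; split; first by rewrite Euclid_dvdM // negb_or pd.
by exists (z * z')%R; rewrite natrM intrM -ez -ez'; ring.
Qed.

Lemma Zloc_sum (I : eqType) (r : seq I) (P : pred I) (F : I -> rat) :
  (forall i, i \in r -> P i -> Zloc p (F i)) -> Zloc p (\sum_(i <- r | P i) F i).
Proof.
move=> FZ; rewrite big_seq_cond.
apply: (big_rec (fun x => Zloc p x)) => [|i x /andP[ri Pi] xZ]; first exact: (Zloc_nat 0).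
by apply: ZlocD => //; apply: FZ.
Qed.

Lemma Zloc_natV n : ~~ (p %| n)%N -> Zloc p n%:R^-1.
Proof.
move=> pn; apply/ZlocP; exists n; split=> //; exists 1%R.
by rewrite divff // pnatr_eq0; apply: contraNneq pn => ->; rewrite dvdn0.
Qed.

Lemma Zloc_sign n : Zloc p ((-1) ^+ n).
Proof. by rewrite -signr_odd; case: odd; [apply: (Zloc_int (-1)) | apply: (Zloc_nat
  1)]. Qed.

(* Whence [p^k / k] is divisible by [p^4] in the logarithm of a series 1 mod p. *)
Lemma Zloc_powV k : (5 <= p)%N -> (4 <= k)%N -> Zloc p (p%:R ^+ (k - 4) / k%:R).
Proof.
move=> p5 k4; have k0 : (0 < k)%N by apply: leq_trans k4.
have [m pm ek] := pfactor_coprime p_prime k0; set v := logn p k in ek.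
have pm' : ~~ (p %| m)%N by rewrite -prime_coprime.
have v_le : (v <= k - 4)%N.
  case: (posnP v) => [->//|v0].
  have : (v + 4 <= p ^ v)%N.
    have le5 : (5 ^ v <= p ^ v)%N by rewrite leq_exp2r.
    apply: leq_trans le5; elim: {ek} v v0 => // -[|v] IHv _ //.
    by have := IHv isT; rewrite !expnS; lia.
  have m0 : (0 < m)%N by case: (m) pm' => //; rewrite dvdn0.
  have : (p ^ v <= k)%N by rewrite ek leq_pmull.
  lia.
have p0 : p%:R != 0 :> rat by rewrite pnatr_eq0 -lt0n prime_gt0.
have -> : p%:R ^+ (k - 4) / k%:R = p%:R ^+ (k - 4 - v) * m%:R^-1 :> rat.
  have -> : k%:R = m%:R * p%:R ^+ v :> rat by rewrite -natrX -natrM -ek.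
  rewrite -{1}(subnK v_le) exprD -mulf_div divff ?expf_neq0 //.
  by rewrite mulr1.
by rewrite -natrX; apply: ZlocM (Zloc_nat _) (Zloc_natV _).
Qed.

End Zloc.

Section Congruences.
Variable p : nat.
Hypothesis p_prime : prime p.
Implicit Types f g h : fps rat.

Let p0 : (0 < p)%N := prime_gt0 p_prime.

(** * Power series over Z_(p) and their congruences *)

Definition pintegral f := forall n, Zloc p (fcoef f n).

Lemma pintegralC x : Zloc p x -> pintegral (fpsC x).
Proof. by move=> xZ n /=; case: ifP => // _; exact: (Zloc_nat p_prime 0). Qed.
Lemma pintegralD f g : pintegral f -> pintegral g -> pintegral (f + g).
Proof. by move=> fZ gZ n; rewrite fcoefD ZlocD. Qed.
Lemma pintegralN f : pintegral f -> pintegral (- f).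
Proof. by move=> fZ n; rewrite fcoefN ZlocN. Qed.
Lemma pintegralM f g : pintegral f -> pintegral g -> pintegral (f * g).
Proof. by move=> fZ gZ n; rewrite fcoefM Zloc_sum // => i _ _; rewrite ZlocM. Qed.
Lemma pintegral1 : pintegral 1.
Proof. exact: (pintegralC (Zloc_nat p_prime 1)). Qed.
Lemma pintegral_nat k : pintegral k%:R.
Proof.
elim: k => [|k IHk]; first exact: (pintegralC (Zloc_nat p_prime 0)).
by rewrite mulrS; apply: pintegralD => //; apply: pintegral1.
Qed.
Lemma pintegralX f k : pintegral f -> pintegral (f ^+ k).
Proof.
move=> fZ; elim: k => [|k IHk]; first exact: pintegral1.
by rewrite exprS; apply: pintegralM.
Qed.
Lemma pintegral_sum (I : eqType) (r : seq I) (P : pred I) (F : I -> fps rat) :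
  (forall i, i \in r -> P i -> pintegral (F i)) -> pintegral (\sum_(i <- r | P i) F i).
Proof. by move=> FZ n; rewrite fcoef_sum Zloc_sum // => i ri Pi; apply: FZ. Qed.
Lemma pintegral_subX f : pintegral f -> pintegral (fps_subX p f).
Proof.
by move=> fZ n; rewrite fcoef_subX; case: ifP => // _; exact: (Zloc_nat p_prime 0).
Qed.
Lemma pintegral_fpsX : pintegral (fpsX rat).
Proof. by move=> n /=; case: ifP => _; [exact: (Zloc_nat p_prime 1) | exact:
  (Zloc_nat p_prime 0)]. Qed.

Lemma fps_unit1 f : fcoef f 0%N = 1 -> f \is a GRing.unit.
Proof. by rewrite fps_unitE => ->; rewrite oner_eq0. Qed.

Lemma fcoefV0 f : fcoef f 0%N = 1 -> fcoef f^-1 0%N = 1.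
Proof.
move=> f0; have := fcoefM0 f f^-1.
by rewrite divrr ?fps_unit1 // f0 mul1r fcoef1 => <-.
Qed.

Lemma fcoefX0 f k : fcoef f 0%N = 1 -> fcoef (f ^+ k) 0%N = 1.
Proof. by move=> f0; elim: k => // k IHk; rewrite exprS fcoefM0 f0 IHk mul1r. Qed.

Lemma pintegralV f : pintegral f -> fcoef f 0%N = 1 -> pintegral f^-1.
Proof.
move=> fZ f0; elim/ltn_ind => n IHn.
have : fcoef (f * f^-1) n = fcoef 1 n by rewrite divrr ?fps_unit1.
rewrite fcoefM big_ord_recl f0 mul1r subn0 => /eqP; rewrite -subr_eq0 addrAC addr_eq0.
set s := \sum_(i < n) _ => /eqP e.
have -> : fcoef f^-1 n = fcoef 1 n - s by rewrite -(opprK s) -e; ring.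
apply: (ZlocD p_prime); first exact: pintegral1.
apply: ZlocN; apply: Zloc_sum => // i _ _; apply: (ZlocM p_prime) => //; apply: IHn.
by rewrite /= /bump; have := ltn_ord i; lia.
Qed.

Definition fcong (k : nat) f g := exists2 h, pintegral h & f - g = (p ^ k)%:R * h.

Lemma fcong_refl k f : fcong k f f.
Proof. by exists 0; [exact: (pintegral_nat 0) | rewrite subrr mulr0]. Qed.
Lemma fcong_sym k f g : fcong k f g -> fcong k g f.
Proof.
by case=> h hZ e; exists (- h); [exact: pintegralN | rewrite mulrN -e opprB].
Qed.
Lemma fcong_trans k f g h : fcong k f g -> fcong k g h -> fcong k f h.
Proof.
case=> u uZ e [v vZ e']; exists (u + v); first exact: pintegralD.
by rewrite mulrDr -e -e'; ring.
Qed.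
Lemma fcongD k f f' g g' : fcong k f f' -> fcong k g g' -> fcong k (f + g) (f' + g').
Proof.
case=> u uZ e [v vZ e']; exists (u + v); first exact: pintegralD.
by rewrite mulrDr -e -e'; ring.
Qed.
Lemma fcongMl k f g h : pintegral h -> fcong k f g -> fcong k (h * f) (h * g).
Proof.
move=> hZ [u uZ e]; exists (h * u); first exact: pintegralM.
by rewrite mulrCA -e; ring.
Qed.
Lemma fcongM k f f' g g' : pintegral f -> pintegral g' ->
  fcong k f f' -> fcong k g g' -> fcong k (f * g) (f' * g').
Proof.
move=> fZ gZ ff' gg'; apply: (fcong_trans (fcongMl fZ gg')).
by rewrite mulrC [f' * _]mulrC; apply: fcongMl.
Qed.
Lemma fcongN k f g : fcong k f g -> fcong k (- f) (- g).
Proof. by rewrite -(mulN1r f) -(mulN1r g); apply: fcongMl;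
  apply/pintegralN/pintegral1. Qed.
Lemma fcongX k f g m : pintegral f -> pintegral g ->
  fcong k f g -> fcong k (f ^+ m) (g ^+ m).
Proof.
move=> fZ gZ fg; elim: m => [|m IHm]; first exact: fcong_refl.
by rewrite !exprS; apply: fcongM => //; apply: pintegralX.
Qed.

Lemma pintegral_fcong k f g : fcong k f g -> pintegral g -> pintegral f.
Proof.
case=> h hZ e gZ; rewrite -(subrK g f) e; apply: pintegralD => //.
by apply: pintegralM => //; apply: pintegral_nat.
Qed.

(** Stable under products and inverses, so for [tau] only the factors 1 - q^n need checking: each
    coefficient involves finitely many of them. *)
Definition frob f := [/\ pintegral f, fcoef f 0%N = 1 & fcong 1 (f ^+ p) (fps_subX p f)].

Lemma frobM f g : frob f -> frob g -> frob (f * g).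
Proof.
move=> [fZ f0 ff] [gZ g0 gg]; split; first exact: pintegralM.
  by rewrite fcoefM0 f0 g0 mulr1.
rewrite exprMn fps_subXM //; apply: fcongM => //; first exact: pintegralX.
exact: pintegral_subX.
Qed.

Lemma frob1 : frob 1.
Proof.
split=> //; first exact: pintegral1.
by rewrite expr1n fps_subX1 //; apply: fcong_refl.
Qed.

Lemma frobX f k : frob f -> frob (f ^+ k).
Proof.
by move=> ff; elim: k => [|k IHk]; rewrite ?exprS; [exact: frob1 | exact: frobM].
Qed.

Lemma subX_V f : fcoef f 0%N = 1 -> fps_subX p f^-1 = (fps_subX p f)^-1.
Proof.
move=> f0; have s0 : fcoef (fps_subX p f) 0%N = 1 by rewrite fcoef_subX dvdn0 div0n.
apply: (mulrI (fps_unit1 s0)).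
by rewrite -fps_subXM // !divrr ?fps_unit1 // fps_subX1.
Qed.

Lemma fps_subXX f k : fps_subX p (f ^+ k) = fps_subX p f ^+ k.
Proof. by elim: k => [|k IHk]; rewrite ?fps_subX1 // !exprS fps_subXM // IHk. Qed.

Lemma frobV f : frob f -> frob f^-1.
Proof.
move=> [fZ f0 ff]; have gZ := pintegralV fZ f0.
split=> //; first exact: fcoefV0.
rewrite subX_V //; set s := fps_subX p f in ff *.
have s0 : fcoef s 0%N = 1 by rewrite fcoef_subX dvdn0 div0n.
have sZ : pintegral s^-1 by apply: pintegralV => //; apply: pintegral_subX.
have := fcongMl (pintegralM (pintegralX p gZ) sZ) (fcong_sym ff).
have -> : f^-1 ^+ p * s^-1 * s = f^-1 ^+ p by rewrite mulrVK ?fps_unit1.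
have -> // : f^-1 ^+ p * s^-1 * f ^+ p = s^-1.
by rewrite mulrAC -exprMn mulVr ?fps_unit1 // expr1n mul1r.
Qed.

Lemma subX_fpsXn n : fps_subX p (fpsX rat ^+ n) = fpsX rat ^+ (n * p).
Proof.
apply/fpsP => m; rewrite fcoef_subX !fcoef_fpsXn; case: ifP => pm.
  by rewrite -{2}(divnK pm) eqn_pmul2r.
by case: eqP => // em; rewrite em dvdn_mull in pm.
Qed.

Lemma frob_1subX n : odd p -> (0 < n)%N -> frob (1 - fpsX rat ^+ n).
Proof.
move=> p_odd n0; have XZ : pintegral (- fpsX rat ^+ n).
  by apply/pintegralN/pintegralX/pintegral_fpsX.
split; first by apply: pintegralD => //; apply: pintegral1.
  by rewrite (agree_1subX n0).
rewrite fps_subXD fps_subXN fps_subX1 // subX_fpsXn exprDn.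
rewrite -(prednK p0) big_ord_recr big_ord_recl /= !prednK // expr0 bin0 binn.
rewrite subnn !expr1n !mulr1n !mul1r.
have -> : (- fpsX rat ^+ n) ^+ p = - fpsX rat ^+ (n * p).
  by rewrite exprNn -signr_odd p_odd expr1 mulN1r exprM.
exists (\sum_(i < p.-1) ('C(p, i.+1) %/ p)%:R * (- fpsX rat ^+ n) ^+ i.+1).
  apply: pintegral_sum => i _ _; apply: pintegralM; first exact: pintegral_nat.
  exact: pintegralX.
rewrite expn1 mulr_sumr [1 + _]addrC -addrA addrK.
apply: eq_bigr => i _; rewrite /bump add1n expr1n mul1r mulrA -natrM mulnC divnK
  ?mulr_natl //.
by apply: prime_dvd_bin => //=; rewrite -ltn_predRL ltn_ord.
Qed.
Hypothesis p_ge5 : (5 <= p)%N.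

Let pR0 k : (p ^ k)%:R != 0 :> rat.
Proof. by rewrite pnatr_eq0 -lt0n expn_gt0 p0. Qed.

Let p_odd : odd p.
Proof. by case: (even_prime p_prime) => // p2; move: p_ge5; rewrite p2. Qed.

Lemma fcongP k f g :
  (forall n, congp p k (fcoef f n) (fcoef g n)) -> fcong k f g.
Proof.
move=> fg; exists (Fps (fun n => (fcoef f n - fcoef g n) / (p ^ k)%:R)).
  by move=> n /=; have [z zZ ->] := fg n; rewrite mulrAC divff ?mul1r.
by apply/fpsP => n; rewrite fcoef_natl fcoefB /= mulrC divfK.
Qed.

Lemma fcong_coef k f g n : fcong k f g -> congp p k (fcoef f n) (fcoef g n).
Proof.
by case=> h hZ /fpsP/(_ n); rewrite fcoefB fcoef_natl => e; exists (fcoef h n).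
Qed.

Lemma frob_tau_factor n : (0 < n)%N -> frob (tau_factor n).
Proof.
move=> n0; apply: frobM => //; first by apply/frobX/frob_1subX; rewrite ?muln_gt0.
by apply: frobV => //; apply: frobX => //; apply: frob_1subX.
Qed.

Lemma frob_tau : frob tau.
Proof.
have fT N : frob (\prod_(1 <= n < N.+1) tau_factor n).
  rewrite big_seq; apply: (big_ind frob); first exact: frob1.
    by move=> f g ff fg; apply: frobM.
  by move=> n; rewrite mem_index_iota => /andP[n0 _]; apply: frob_tau_factor.
split; last 1 first.
- apply: fcongP => n; have tT := @agree_tau n; have [_ _ /(fcong_coef n)] := fT n.
  rewrite (agreeX p tT) // !fcoef_subX; case: ifP => // _.
  by rewrite tT // ltnS leq_div.
- by move=> n; rewrite -(@agree_tau n) //; have [fZ _ _] := fT n; apply: fZ.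
- exact: fcoef_tau0.
Qed.

(** * The quotient t(q)^p / t(q^p) modulo p^4 *)

Definition tau_quot : fps rat := tau ^+ p / fps_subX p tau.

Lemma fcoef_subX_tau0 : fcoef (fps_subX p tau) 0%N = 1.
Proof. by rewrite fcoef_subX dvdn0 div0n fcoef_tau0. Qed.

Lemma fcoef_tau_quot0 : fcoef tau_quot 0%N = 1.
Proof. by rewrite fcoefM0 (fcoefX0 _ fcoef_tau0) (fcoefV0 fcoef_subX_tau0) mulr1. Qed.

Lemma tau_quot_cong : fcong 1 tau_quot 1.
Proof.
have [tZ t0 ft] := frob_tau.
have sZ : pintegral (fps_subX p tau)^-1.
  by apply: pintegralV fcoef_subX_tau0 => //; apply: pintegral_subX.
have := fcongMl sZ ft.
by rewrite mulVr ?fps_unit1 ?fcoef_subX_tau0 // mulrC.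
Qed.

Lemma UE : U p = fps_log tau_quot.
Proof.
rewrite /U; congr fps_log; congr (_ / _).
  by apply/fpsP => n; rewrite -[LHS]/(fcoef (tq ^+ p) (n + p)) tqE exprMn addnC fcoefXnM.
apply/fpsP => n; rewrite -[LHS]/(fcoef (fps_subX p tq) (n + p)) tqE fps_subXM //.
by rewrite -[fpsX rat]expr1 subX_fpsXn // mul1n addnC fcoefXnM.
Qed.

(** The factor 6 makes the coefficients of v, v^2, v^3 in log(1 + 6 v) integers. The k-th term
    contains p^k / k, which lies in p^4 Z_(p) for k >= 4 by [Zloc_powV]. *)
Lemma fps_log_cong (w : fps rat) : pintegral w -> fcoef w 0%N = 0 ->
  let v := p%:R * w in
  fcong 4 (fps_log (1 + 6 * v)) (6 * v - 18 * v ^+ 2 + 72 * v ^+ 3).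
Proof.
move=> wZ w0 v; have u0 : fcoef (6 * v) 0%N = 0 by rewrite !fcoef_natl w0 !mulr0.
apply: fcongP => n.
(* Extending the range to n + 4 adds only zero terms and ensures that k = 1, 2, 3 occur even for n <
   3. *)
have -> : fcoef (fps_log (1 + 6 * v)) n = \sum_(1 <= k < n + 4)
    (-1) ^+ k.+1 / k%:R * fcoef ((6 * v) ^+ k) n.
  rewrite /= [1 + _]addrC addrK.
  rewrite [RHS](@big_cat_nat _ _ _ n.+1) //=; last by rewrite addnS ltnS leq_addr.
  rewrite [X in _ = _ + X]big_nat_cond [X in _ = _ + X]big1 ?addr0 //.
  by move=> k /andP[/andP[k_gt _] _]; rewrite fcoefX_small ?mulr0.
have eq4 k : (4 <= k)%N -> (-1) ^+ k.+1 / k%:R * fcoef ((6 * v) ^+ k) n =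
    (p ^ 4)%:R * ((-1) ^+ k.+1 * (p%:R ^+ (k - 4) / k%:R) * fcoef ((6 * w) ^+ k) n).
  move=> k4; have -> : (6 * v) ^+ k = (p ^ k)%:R * (6 * w) ^+ k.
    by rewrite natrX -exprMn /v mulrCA.
  rewrite fcoef_natl.
  have -> : (p ^ k)%:R = (p ^ 4)%:R * p%:R ^+ (k - 4) :> rat.
    by rewrite -natrX -natrM -expnD subnKC.
  move: ((-1) ^+ k.+1) (fcoef _ _) (k%:R^-1) (p%:R ^+ (k - 4)) ((p ^ 4)%:R) => x y z t u.
  ring.
exists (\sum_(4 <= k < n + 4) (-1) ^+ k.+1 * (p%:R ^+ (k - 4) / k%:R) *
    fcoef ((6 * w) ^+ k) n).
  apply: Zloc_sum => // k; rewrite mem_index_iota => /andP[k4 _] _.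
  apply: ZlocM => //; first by apply: ZlocM; rewrite ?Zloc_sign ?Zloc_powV.
  exact: (pintegralX k (pintegralM (pintegral_nat 6) wZ) n).
rewrite mulr_sumr -(eq_big_nat _ _ (fun k kn => eq4 k (proj1 (andP kn)))).
have split4 (F : nat -> rat) : \sum_(1 <= k < n + 4) F k =
    F 1%N + F 2%N + F 3%N + \sum_(4 <= k < n + 4) F k.
  rewrite (@big_cat_nat _ _ _ 4) ?leq_addl //=; congr (_ + _).
  by rewrite unlock /= addr0 addrA.
rewrite (split4 (fun k => (-1) ^+ k.+1 / k%:R * fcoef ((6 * v) ^+ k) n)) expr1 {split4}.
apply/eqP; rewrite addrAC -subr_eq0 addrK subr_eq0; apply/eqP.
have -> : fcoef ((6 * v) ^+ 2) n = 36 * fcoef (v ^+ 2) n.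
  by rewrite -fcoef_natl exprMn -natrX.
have -> : fcoef ((6 * v) ^+ 3) n = 216 * fcoef (v ^+ 3) n.
  by rewrite -fcoef_natl exprMn -natrX.
rewrite fcoefD fcoefB (fcoef_natl 6) (fcoef_natl 18) (fcoef_natl 72).
move: (fcoef v n) (fcoef (v ^+ 2) n) (fcoef (v ^+ 3) n) => x y z.
by field.
Qed.

Lemma Zloc_natV_small n : (0 < n < p)%N -> Zloc p n%:R^-1.
Proof. by move=> /andP[n0 np]; apply: Zloc_natV => //; rewrite gtnNdvd. Qed.

Definition kappa : fps rat := fpsC 6^-1.

Lemma kappaE : 6 * kappa = 1.
Proof. by apply/fpsP => n; rewrite fcoef_natl fcoef1 /=; case: ifP; rewrite ?mulr0. Qed.

Lemma pintegral_kappa : pintegral kappa.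
Proof.
apply: pintegralC => //; have -> : 6^-1 = 2^-1 * 3^-1 :> rat by [].
by apply: ZlocM => //; apply: Zloc_natV_small => //; apply: leq_trans p_ge5.
Qed.

(* The exponential series of [- m u], cut after the third power; [kappa] is 1/6. *)
Definition exp_cut (m : nat) (u : fps rat) : fps rat :=
  1 - m%:R * u + 3 * kappa * m%:R ^+ 2 * u ^+ 2 - kappa * m%:R ^+ 3 * u ^+ 3.

Ltac pint := repeat match goal with
  | |- pintegral (_ + _) => apply: pintegralD
  | |- pintegral (- _) => apply: pintegralN
  | |- pintegral (_ * _) => apply: pintegralM
  | |- pintegral (_ %:R) => exact: pintegral_nat
  | |- pintegral 1 => exact: pintegral1
  | |- pintegral (_ ^+ _) => apply: pintegralX
  end; try assumption.

Lemma exp_cut_cong m u u' : pintegral u -> pintegral u' -> fcong 4 u u' ->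
  fcong 4 (exp_cut m u) (exp_cut m u').
Proof.
move=> uZ uZ' uu'; have kZ := pintegral_kappa.
have mZ j : pintegral (m%:R ^+ j) by apply: pintegralX => //; apply: pintegral_nat.
have Z3 : pintegral 3 by apply: pintegral_nat.
have cX j x : pintegral x -> fcong 4 (x * u ^+ j) (x * u' ^+ j).
  by move=> xZ; apply: fcongMl => //; apply: fcongX.
rewrite /exp_cut; apply: fcongD => //; last first.
  by apply: fcongN => //; apply: cX; apply: pintegralM.
apply: fcongD => //; last by apply: cX; apply: pintegralM => //; apply: pintegralM.
apply: fcongD => //; first exact: fcong_refl.
by apply: fcongN => //; apply: (cX 1); exact: (mZ 1).
Qed.

(** No exponential series is formed. With [tau_quot] = 1 + 6 v and v divisible by p, both sides are
    compared modulo v^4 with one cubic polynomial [E1 m] in v. *)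
Lemma tau_quot_exp (m : nat) : fcong 4 (tau_quot^-1 ^+ m) (exp_cut m (U p)).
Proof.
have [w wZ ew] := tau_quot_cong.
have w0 : fcoef w 0%N = 0.
  move/fpsP: (ew) => /(_ 0%N); rewrite fcoefB fcoef_tau_quot0 fcoef1 subrr fcoef_natl.
  by move/esym/eqP; rewrite mulf_eq0 (negbTE (pR0 1)) => /eqP.
set x := kappa * w; set v := p%:R * x.
have xZ : pintegral x by apply: pintegralM => //; exact: pintegral_kappa.
have vZ : pintegral v by apply: pintegralM => //; exact: pintegral_nat.
have eV : tau_quot = 1 + 6 * v.
  have -> : 6 * v = p%:R * w * (6 * kappa) by rewrite /v /x; ring.
  by rewrite kappaE mulr1 -[p%:R]/(p ^ 1)%:R -[p in (p ^ 1)%N]expn1 -ew; ring.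
set u := 6 * v - 18 * v ^+ 2 + 72 * v ^+ 3.
have eU : fcong 4 (U p) u.
  rewrite UE eV; apply: fps_log_cong => //.
  by rewrite /x fcoefM0 w0 mulr0.
have VZ : pintegral tau_quot by rewrite eV; pint.
have VVZ : pintegral tau_quot^-1 by apply: pintegralV => //; exact: fcoef_tau_quot0.
have uZ : pintegral u by rewrite /u; pint.
have cut4 f g z : pintegral z -> f - g = v ^+ 4 * z -> fcong 4 f g.
  move=> zZ e; exists (x ^+ 4 * z); first by apply: pintegralM => //; exact: pintegralX.
  by rewrite e /v exprMn natrX mulrA.
(* [exp_cut k u] with the powers of v from v^4 on dropped; it is also the binomial series of (1 + 6
   v)^-k cut after v^3. *)
pose E1 k : fps rat := 1 - 6 * k%:R * (v - 3 * v ^+ 2 + 12 * v ^+ 3) +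
  18 * k%:R ^+ 2 * (v ^+ 2 - 6 * v ^+ 3) - 36 * k%:R ^+ 3 * v ^+ 3.
have e1 k : fcong 4 (exp_cut k u) (E1 k).
  (* Chosen so that u = 6 v (1 + s). As s is divisible by v, the cofactors of v^4 in u^2 and u^3 can
     be written down. *)
  pose s := 12 * v ^+ 2 - 3 * v.
  apply: (cut4 _ _ (18 * k%:R ^+ 2 * (33 - 72 * v + 144 * v ^+ 2) -
    36 * k%:R ^+ 3 * ((12 * v - 3) * (3 + 3 * s + s ^+ 2)))).
    by rewrite /s; pint.
  pose y := v - 3 * v ^+ 2 + 12 * v ^+ 3.
  apply: (lincomb1 kappaE (c := 18 * k%:R ^+ 2 * y ^+ 2 - 36 * k%:R ^+ 3 * y ^+ 3)).
  by rewrite /exp_cut /E1 /u /y /s; ring.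
(* All terms cancel except 6 v times the cubic term of [E1 k.+1]. *)
have e2 k : fcong 4 (tau_quot * E1 k.+1) (E1 k).
  apply: (cut4 _ _ (- 6 * (72 * k.+1%:R + 108 * k.+1%:R ^+ 2 + 36 * k.+1%:R ^+ 3)));
    first by pint.
  by rewrite eV /E1 -(natr1 k); ring.
have e3 : fcong 4 (tau_quot ^+ m * E1 m) 1.
  elim: m => [|k IHk].
    have -> : tau_quot ^+ 0 * E1 0%N = 1 by rewrite /E1 expr0; ring.
    exact: fcong_refl.
  rewrite exprS -mulrA mulrCA; apply: fcong_trans IHk => //.
  by apply: fcongMl => //; exact: pintegralX.
have e4 : fcong 4 (E1 m) (tau_quot^-1 ^+ m).
  have := fcongMl (pintegralX m VVZ) e3; rewrite mulr1 mulrA -exprMn.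
  by rewrite mulVr ?expr1n ?mul1r // fps_unit1 ?fcoef_tau_quot0.
apply: fcong_sym; apply: fcong_trans e4; apply: fcong_trans (e1 m).
by apply: exp_cut_cong => //; apply: pintegral_fcong eU _.
Qed.

Lemma pintegral_Cq : pintegral Cq.
Proof.
rewrite Cq_mC; apply: pintegralD; first exact: pintegral1.
apply: pintegralM; first exact: pintegral_nat.
move=> [|n]; first by rewrite fcoef_lam0; exact: (Zloc_nat p_prime 0).
rewrite fcoef_lam // Zloc_sum // => d _ _; rewrite -natrX ZlocM ?Zloc_nat //.
rewrite chi3E; do 2?case: ifP => _; [exact: (Zloc_nat p_prime 0) |
  exact: (Zloc_nat p_prime 1) | exact: (Zloc_int p_prime (-1))].
Qed.

Lemma congp_trans k x y z : congp p k x y -> congp p k y z -> congp p k x z.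
Proof.
case=> u uZ e [v vZ e']; exists (u + v); first exact: ZlocD.
by rewrite mulrDr -e -e'; ring.
Qed.

Lemma congp0D k x y : congp p k x 0 -> congp p k y 0 -> congp p k (x + y) 0.
Proof.
case=> u uZ e [v vZ e']; exists (u + v); first exact: ZlocD.
by rewrite mulrDr -e -e'; ring.
Qed.

Lemma congp0M k x y : Zloc p x -> congp p k y 0 -> congp p k (x * y) 0.
Proof.
move=> xZ [u uZ e]; exists (x * u); first exact: ZlocM.
by rewrite mulrCA -e; ring.
Qed.

Lemma congp0_sum k (I : eqType) (r : seq I) (F : I -> rat) :
  (forall i, i \in r -> congp p k (F i) 0) -> congp p k (\sum_(i <- r) F i) 0.
Proof.
move=> F0; rewrite big_seq; apply: (big_ind (fun x => congp p k x 0)) => //.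
  by exists 0; [exact: (Zloc_nat p_prime 0) | rewrite mulr0 subrr].
by move=> x y; apply: congp0D.
Qed.

(** A divisor d of n p that does not divide n is a multiple of p, so its term [chi3 d] d^4 is
    divisible by p^4. *)
Lemma Cq_mulp n : congp p 4 (fcoef Cq (n * p)%N) (fcoef Cq n).
Proof.
case: (posnP n) => [->|n0].
  by exists 0; [exact: (Zloc_nat p_prime 0) | rewrite mul0n subrr mulr0].
have np0 : (0 < n * p)%N by rewrite muln_gt0 n0.
rewrite /= !gtn_eqF // /c.
rewrite (bigID (fun d => d %| n)%N) /= mulrDr.
have -> : \sum_(d <- divisors (n * p) | (d %| n)%N) chi3 d * d%:R ^+ 4 =
    \sum_(d <- divisors n) chi3 d * d%:R ^+ 4.
  rewrite -big_filter; apply: perm_big; apply: uniq_perm; rewrite ?filter_uniq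
    ?divisors_uniq //.
  move=> d; rewrite mem_filter -!dvdn_divisors //.
  by case: (boolP (d %| n)%N) => // dn; rewrite dvdn_mulr.
have [z zZ ez] : congp p 4 (3 * \sum_(d <- divisors (n * p) | ~~ (d %| n)%N)
    chi3 d * d%:R ^+ 4) 0.
  apply: congp0M; first exact: (Zloc_nat p_prime 3).
  rewrite -big_filter; apply: congp0_sum => d.
  rewrite mem_filter -dvdn_divisors // => /andP[dn dnp].
  have /dvdnP[e ->] : (p %| d)%N.
    apply: contraNT dn => pd; rewrite -(@Gauss_dvdl d n p) //.
    by rewrite coprime_sym prime_coprime.
  exists (chi3 (e * p) * e%:R ^+ 4); last by rewrite subr0 natrM exprMn natrX; ring.
  apply: ZlocM => //; last by rewrite -natrX Zloc_nat.
  rewrite chi3E; do 2?case: ifP => _; [exact: (Zloc_nat p_prime 0) |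
    exact: (Zloc_nat p_prime 1) | exact: (Zloc_int p_prime (-1))].
by exists z => //; rewrite -ez; ring.
Qed.

(** In a product with a series in q^p, the coefficient of q^(m p) sees the other factor only at
    exponents divisible by p, exactly those covered by the hypothesis and by [Cq_mulp]. *)
Lemma congp_A m :
    (forall n l : nat, (1 <= n)%N -> (1 <= l <= 3)%N ->
       congp p 4 (fcoef (Cq * U p ^+ l) (n * p)%N) 0) ->
  congp p 4 (A (m * p)%N) (A m).
Proof.
move=> hCU; set s := fps_subX p (tau^-1 ^+ m).
have [tZ t0 _] := frob_tau.
have tVZ : pintegral tau^-1 by apply: pintegralV.
have tmZ : pintegral (tau^-1 ^+ m) by apply: pintegralX.
have sZ : pintegral s by apply: pintegral_subX.
have es : tau^-1 ^+ (m * p) = s * tau_quot^-1 ^+ m.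
  have st : fps_subX p tau \is a GRing.unit by rewrite fps_unit1 ?fcoef_subX_tau0.
  rewrite /s fps_subXX /tau_quot subX_V // -exprMn invrM ?unitrX ?unitrV ?tau_unit //.
  by rewrite invrK mulrA mulVr // mul1r mulnC exprM -exprVn.
have fcoefs f : fcoef (s * f) (m * p)%N =
    \sum_(0 <= i < m.+1) fcoef (tau^-1 ^+ m) i * fcoef f ((m - i) * p)%N.
  by rewrite fcoefM_subX // mulnK //; apply: eq_bigr => i _; rewrite mulnBl.
have U0 : fcoef (U p) 0%N = 0 by rewrite /U /= big_geq.
have cU l : (1 <= l <= 3)%N -> congp p 4 (fcoef (s * (Cq * U p ^+ l)) (m * p)%N) 0.
  move=> l13; rewrite fcoefs; apply: congp0_sum => i _; apply: congp0M; first exact: tmZ.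
  (* The hypothesis says nothing about exponent 0; there the coefficient vanishes because [U p] has
     no constant term and l >= 1. *)
  case: (posnP (m - i)%N) => [->|mi]; last exact: hCU.
  rewrite mul0n fcoefM0 fcoefX_small // ?mulr0; last by case/andP: l13.
  by exists 0; [exact: (Zloc_nat p_prime 0) | rewrite mulr0 subrr].
have c0 : congp p 4 (fcoef (s * Cq) (m * p)%N) ((-1) ^+ m * A m).
  rewrite -fcoef_Cq_tau [Cq * _]mulrC fcoefs fcoefM.
  rewrite -(big_mkord xpredT (fun i => fcoef (tau^-1 ^+ m) i * fcoef Cq (m - i)%N)).
  have [z zZ ez] : congp p 4 (\sum_(0 <= i < m.+1) fcoef (tau^-1 ^+ m) i *
      (fcoef Cq ((m - i) * p)%N - fcoef Cq (m - i)%N)) 0.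
    apply: congp0_sum => i _; apply: congp0M; first exact: tmZ.
    by have [z zZ e] := Cq_mulp (m - i)%N; exists z; rewrite // subr0.
  exists z => //; rewrite -ez subr0 -sumrB.
  by apply: eq_bigr => i _; rewrite mulrBr.
have c1 : congp p 4 (fcoef (Cq * tau^-1 ^+ (m * p)) (m * p)%N) (fcoef (s * Cq) (m * p)%N).
  rewrite es; have CsZ : pintegral (Cq * s) by apply: pintegralM => //; exact:
    pintegral_Cq.
  rewrite mulrA; apply: congp_trans (fcong_coef _ (fcongMl CsZ (tau_quot_exp m))) _.
  have -> : Cq * s * exp_cut m (U p) = s * Cq + (- (m%:R * (s * (Cq * U p ^+ 1))) +
      (kappa * ((3 * m ^ 2)%:R * (s * (Cq * U p ^+ 2))) +
       - (kappa * ((m ^ 3)%:R * (s * (Cq * U p ^+ 3)))))).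
    by rewrite /exp_cut natrM !natrX; ring.
  rewrite fcoefD; set x := fcoef (_ + _) _.
  have : congp p 4 x 0.
    have k6 : Zloc p 6^-1 by exact: (pintegral_kappa 0%N).
    have N0 y : congp p 4 y 0 -> congp p 4 (- y) 0.
      by move=> y0; rewrite -mulN1r; apply: congp0M => //; apply: (Zloc_int p_prime (-1)).
    rewrite /x !fcoefD !fcoefN !fcoefCM !fcoef_natl.
    apply: congp0D; first by apply: N0; apply: congp0M; [exact: Zloc_nat | exact: cU].
    by apply: congp0D; [|apply: N0]; apply: congp0M => //; apply: congp0M;
      rewrite ?Zloc_nat ?cU //; apply: cU.
  by case=> z zZ; rewrite subr0 => ez; exists z; rewrite // -ez addrAC subrr add0r.
have [z zZ ez] := congp_trans c1 c0.
exists ((-1) ^+ m * z); first by apply: ZlocM => //; apply: Zloc_sign.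
(* Since p is odd, the signs attached to A_(mp) and A_m agree and cancel. *)
have sp : (-1) ^+ (m * p) = (-1) ^+ m :> rat by rewrite -signr_odd oddM p_odd andbT
  signr_odd.
rewrite mulrCA -ez fcoef_Cq_tau sp -mulrBr mulrA -expr2.
by rewrite sqrr_sign mul1r.
Qed.

End Congruences.

Theorem theorem5p5 (p : nat) (p_prime : prime p) (p_ge5 : (5 <= p)%N)
    (hCU : forall n l : nat, (1 <= n)%N -> (1 <= l <= 3)%N ->
       congp p 4 (fcoef (Cq * U p ^+ l) (n * p)%N) 0) :
  forall m : nat, (1 <= m)%N -> congp p 4 (A (m * p)%N) (A m).
Proof. by move=> m _; apply: congp_A. Qed.
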